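(* There exists a (randomized) streaming algorithm that, given $n$ elements arriving one by one in a stream in arbitrary order, an integer parameter $k\ge 1$, a noise parameter $\gamma\in(0,1/2]$, and a confidence parameter $\delta\in(0,1)$, with probability at least $1-\delta$ finds the $k$ largest elements of the underlying total order in the noisy comparison model, using a memory of $O(k)$ elements and $O\!\left(\frac{n}{\gamma^2}\cdot\log(k/\delta)\right)$ noisy comparisons.
   Context: Noisy comparison model. There are $n$ elements with an unknown total order. The algorithm may query any pair of elements available to it; for each query, independently of the other queries, the answer agrees with the underlying total order with probability $1/2+\gamma$, and with the remaining probability the answer is arbitrary. The parameters $n,k,\gamma,\delta$ are known to the algorithm. Streaming model. The elements arrive one by one in a stream. To query a pair of elements, both elements must be available at that time, i.e., each is stored in the memory or is the currently arriving element; an element that is not stored, or that is removed from memory, is no longer accessible. The memory is the maximum number of elements stored at any point (auxiliary information such as counters is not counted). The output is the set of the $k$ largest elements, $k\le n$. $O(\cdot)$ hides absolute constants. *)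

(* Defs.v *)
From HB Require Import structures.
From mathcomp Require Import all_boot all_order all_algebra.
From mathcomp Require Import reals exp.

Set Implicit Arguments.
Unset Strict Implicit.
Unset Printing Implicit Defensive.

Import Order.TTheory GRing.Theory Num.Theory.
Local Open Scope ring_scope.

(* A randomized streaming algorithm on n elements, as a decision tree.  The
   algorithm has no access to the elements themselves: it names an element by
   its arrival position in the stream, and learns about the order only from
   the answers to its comparisons.  Auxiliary information (counters, past
   answers, past coins) is the position in the tree, hence is not counted as
   memory.
   [Toss p c] draws a private coin with P(true) = p; [Compare i j c] asks
   whether i is smaller than j; [Next c] lets the next stream element arrive,
   and the previously arriving one is lost unless it has been stored by
   [Store c], which puts the currently arriving element in the memory. *)
Inductive program (R : realType) (n : nat) : Type :=
| Output of {set 'I_n}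
| Toss of R & (bool -> program R n)
| Compare of 'I_n & 'I_n & (bool -> program R n)
| Next of program R n
| Store of program R n
| Discard of 'I_n & program R n.

(* After t arrivals the currently arriving element is the one at position
   t - 1 (there is none when t = 0). *)
Definition arriving (n t : nat) : {set 'I_n} := [set i : 'I_n | i.+1 == t].

(* [t] is the number of elements that have arrived, [mem] the memory. *)
Fixpoint legal_from (R : realType) (n t : nat) (mem : {set 'I_n})
    (A : program R n) : Prop :=
  match A with
  | Output out => out \subset mem
  | Toss p c => 0 <= p <= 1 /\ forall b, legal_from t mem (c b)
  | Compare i j c =>
      [/\ i != j, i \in mem :|: arriving n t, j \in mem :|: arriving n t
        & forall b, legal_from t mem (c b)]
  | Next c => (t < n)%N /\ legal_from t.+1 mem c
  | Store c => legal_from t (mem :|: arriving n t) c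
  | Discard i c => legal_from t (mem :\ i) c
  end.

Definition legal (R : realType) (n : nat) (A : program R n) : Prop :=
  legal_from 0 set0 A.

Fixpoint memory_from (R : realType) (n t : nat) (mem : {set 'I_n})
    (A : program R n) : nat :=
  maxn #|mem|
    match A with
    | Output _ => 0
    | Toss _ c | Compare _ _ c =>
        maxn (memory_from t mem (c true)) (memory_from t mem (c false))
    | Next c => memory_from t.+1 mem c
    | Store c => memory_from t (mem :|: arriving n t) c
    | Discard i c => memory_from t (mem :\ i) c
    end.

(* Maximal number of elements stored at any point, over all executions. *)
Definition memory (R : realType) (n : nat) (A : program R n) : nat :=
  memory_from 0 set0 A.

Fixpoint comparisons (R : realType) (n : nat) (A : program R n) : nat :=
  match A with
  | Output _ => 0
  | Toss _ c => maxn (comparisons (c true)) (comparisons (c false))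
  | Compare _ _ c => (maxn (comparisons (c true)) (comparisons (c false))).+1
  | Next c | Store c | Discard _ c => comparisons c
  end.

(* [Answered r a]: a comparison got the answer a, which was noise-free if r
   and chosen by the adversary otherwise. *)
Inductive event := Tossed of bool | Answered of bool & bool.

(* The arbitrary answers are given by an adversary that sees the whole past
   (most recent event first) and the compared pair.  Being quantified after
   the program and the input, it may depend on them as well. *)
Definition adversary (n : nat) : Type := seq event -> 'I_n -> 'I_n -> bool.

(* Probability that A returns [out] on the stream s, after the history h.
   Every comparison draws a fresh coin: with probability 1/2 + gamma the
   answer is the true one, otherwise it is the adversary's. *)
Fixpoint output_prob_from (R : realType) (gamma : R) (d : Order.disp_t)
    (T : orderType d) (n : nat) (s : n.-tuple T) (adv : adversary n)
    (out : {set 'I_n}) (h : seq event) (A : program R n) : R :=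
  match A with
  | Output out' => (out' == out)%:R
  | Toss p c =>
      p * output_prob_from gamma s adv out (Tossed true :: h) (c true)
      + (1 - p) * output_prob_from gamma s adv out (Tossed false :: h) (c false)
  | Compare i j c =>
      let truth := (tnth s i < tnth s j)%O in
      let lie := adv h i j in
      (1 / 2 + gamma) *
        output_prob_from gamma s adv out (Answered true truth :: h) (c truth)
      + (1 / 2 - gamma) *
        output_prob_from gamma s adv out (Answered false lie :: h) (c lie)
  | Next c | Store c | Discard _ c => output_prob_from gamma s adv out h c
  end.

Definition output_prob (R : realType) (gamma : R) (d : Order.disp_t)
    (T : orderType d) (n : nat) (s : n.-tuple T) (adv : adversary n)
    (A : program R n) (out : {set 'I_n}) : R :=
  output_prob_from gamma s adv out [::] A.

(* The positions of the k largest elements of a duplicate-free stream. *)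
Definition largest (d : Order.disp_t) (T : orderType d) (n : nat)
    (s : n.-tuple T) (k : nat) : {set 'I_n} :=
  [set i | (#|[set j | (tnth s i < tnth s j)%O]| < k)%N].

(* Main.v *)
(* Elements are compared by votes: a vote of level [l] is the majority of [l * r]
   comparisons and errs with probability at most [e ^+ l], where
   [e = (1 - gamma ^+ 2) ^+ r] is polynomially small in [delta / k].
   The stream is cut into blocks of [k ^ 2] elements.  Within a block a buffer of
   [2 * k] elements is pruned to its [k] largest by linear-time selection (median
   of medians); a wrong vote only matters in the at most [k] blocks containing one
   of the [k] largest elements, so a union bound over [poly k] votes is enough.
   The winners of each block then enter a cascade of [k] slots, where the loser of
   slot [j] challenges slot [j + 1].  A champion has a health; a challenger must
   win votes of levels 1, 2, ... and each win of level [i] costs the champion [i]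
   units, while resisting a challenge earns it one unit.  Hence the total cost of
   the votes is amortized by the health, the health of the champion of rank [j] in
   slot [j] drifts upwards, and it is ever dethroned with probability [O(e ^ (1/2))],
   whatever the length of the stream. *)
Require Import Defs.
From HB Require Import structures.
From mathcomp Require Import all_boot all_order all_algebra.
From mathcomp Require Import reals sequences exp.
From mathcomp Require Import zify ring lra.

Set Implicit Arguments.
Unset Strict Implicit.
Unset Printing Implicit Defensive.

Import Order.TTheory GRing.Theory Num.Theory.
Local Open Scope ring_scope.

(** * Vote trees and selection *)

(* [Vote i j l c] asks whether [i] is smaller than [j] by a vote of level [l]. *)
Inductive tree (I X : Type) : Type :=
| Ret of X
| Vote of I & I & nat & (bool -> tree I X).
Arguments Ret {I X} _.

Fixpoint bind I X Y (t : tree I X) (g : X -> tree I Y) : tree I Y :=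
  match t with
  | Ret x => g x
  | Vote i j l c => Vote i j l (fun b => bind (c b) g)
  end.

(* Lowers every vote to level 1, the only level of the selection trees. *)
Fixpoint limit I X (b : nat) (d : X) (t : tree I X) : tree I X :=
  match t, b with
  | Ret x, _ => Ret x
  | Vote _ _ _ _, 0 => Ret d
  | Vote i j l c, b'.+1 => Vote i j 1 (fun a => limit b' d (c a))
  end.

(** * Worst-case semantics of vote trees *)

Section Semantics.
Variables (R : realDomainType) (e : R) (I : Type) (o : I -> I -> bool).

(* Largest expected value of [f] at the leaf when each vote of level [l] errs with
   a probability in [[0, e ^+ l]]. *)
Fixpoint wp X (f : X -> R) (t : tree I X) : R :=
  match t with
  | Ret x => f x
  | Vote i j l c =>
      let wt := wp f (c (o i j)) in
      wt + e ^+ l * Num.max 0 (wp f (c (~~ o i j)) - wt)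
  end.

(** A vote is charged its level, as it is compiled into a number of comparisons proportional to
    it. *)
Fixpoint mcost X (f : X -> nat) (t : tree I X) : nat :=
  match t with
  | Ret x => f x
  | Vote i j l c => (l + maxn (mcost f (c true)) (mcost f (c false)))%N
  end.

Fixpoint eval X (t : tree I X) : X :=
  match t with Ret x => x | Vote i j l c => eval (c (o i j)) end.

Fixpoint ncost X (t : tree I X) : nat :=
  match t with Ret x => 0%N | Vote i j l c => (ncost (c (o i j))).+1 end.

Lemma eval_bind X Y (t : tree I X) (g : X -> tree I Y) :
  eval (bind t g) = eval (g (eval t)).
Proof. by elim: t => //=. Qed.

Lemma ncost_bind X Y (t : tree I X) (g : X -> tree I Y) :
  ncost (bind t g) = (ncost t + ncost (g (eval t)))%N.
Proof. by elim: t => //= i j l c ->; rewrite addSn. Qed.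

Lemma mcost_bind X Y (t : tree I X) (g : X -> tree I Y) (f : Y -> nat) :
  mcost f (bind t g) = mcost (fun x => mcost f (g x)) t.
Proof. by elim: t => //= i j l c IH; rewrite !IH. Qed.

Lemma mcost_limit X (f : X -> nat) (t : tree I X) b d A :
  (forall x, f x <= A)%N -> (mcost f (limit b d t) <= b + A)%N.
Proof.
move=> fA; elim: t b => [x|i j l c IH] [|b] /=.
- exact: fA.
- by rewrite (leq_trans (fA x)) ?leq_addl.
- exact: fA.
- by rewrite add1n addSn ltnS geq_max !IH.
Qed.

Lemma wp_bind X Y (t : tree I X) (g : X -> tree I Y) (f : Y -> R) :
  wp f (bind t g) = wp (fun x => wp f (g x)) t.
Proof. by elim: t => //= i j l c IH; rewrite !IH. Qed.

Hypothesis e01 : 0 <= e <= 1.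

Let el01 l : 0 <= e ^+ l <= 1.
Proof. by case/andP: e01 => e0 e1; rewrite exprn_ge0 ?exprn_ile1. Qed.

(** If the wrong answer is the worse one, the value is at most the mixture of [a + A] and [b + A]
    with weights [1 - e ^+ l] and [e ^+ l], from which a term [- e ^+ l * a] is dropped; otherwise
    [a + A] already bounds it. *)
Lemma wp_Vote_le X (f : X -> R) i j l c (a b A : R) :
  0 <= a -> 0 <= b ->
  wp f (c (o i j)) <= a + A -> wp f (c (~~ o i j)) <= b + A ->
  wp f (Vote i j l c) <= a + e ^+ l * b + A.
Proof.
move=> a0 b0 /=; move: (wp _ _) (wp _ _) (e ^+ l) (el01 l) => y x E /andP[E0 E1] xa yb.
have Eb : 0 <= E * b by rewrite mulr_ge0.
case: (lerP 0 (y - x)) => yx; last by lra.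
have h1 : 0 <= (1 - E) * (a + A - x) by rewrite mulr_ge0 ?subr_ge0.
have h2 : 0 <= E * (b + A - y) by rewrite mulr_ge0 ?subr_ge0.
have h3 : 0 <= E * a by rewrite mulr_ge0.
lra.
Qed.

Lemma wp_le_const X (f : X -> R) t A : (forall x, f x <= A) -> wp f t <= A.
Proof.
move=> fA; elim: t => [x|i j l c IH]; first exact: fA.
by have := @wp_Vote_le X f i j l c 0 0 A; rewrite mulr0 !add0r; apply.
Qed.

Lemma wp_ge0 X (f : X -> R) t : (forall x, 0 <= f x) -> 0 <= wp f t.
Proof.
move=> f0; elim: t => [x|i j l c IH] //=.
by rewrite addr_ge0 ?IH // mulr_ge0 ?le_max ?lexx //; case/andP: (el01 l).
Qed.

(** Union bound over the error-free path: it has at most [b] votes, so it is not truncated, and each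
    vote leaves it with probability at most [e], for a loss of at most 1. *)
Lemma wp_limit X (f : X -> R) t b d :
  (forall x, 0 <= f x <= 1) -> (ncost t <= b)%N ->
  wp f (limit b d t) <= f (eval t) + b%:R * e.
Proof.
move=> f01; have [e0 e1] := andP e01.
elim: t b => [x|i j l c IH] [|b] //=; rewrite ?mul0r ?addr0 //.
- by move=> _; rewrite lerDl mulr_ge0.
- rewrite ltnS => /IH; set u := wp _ _ => uE.
  set w := wp _ _.
  have u0 : 0 <= u by apply: wp_ge0 => x; case/andP: (f01 x).
  have w1 : w <= 1 by apply: wp_le_const => x; case/andP: (f01 x).
  rewrite expr1 -natr1 mulrDl mul1r addrA lerD //.
  by rewrite -[leRHS]mulr1 ler_wpM2l // ge_max ler01; lra.
Qed.

End Semantics.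

(** * Linear-time selection by medians of medians *)

Section Selection.
Local Open Scope nat_scope.
Variables (I : eqType) (o : I -> I -> bool) (d : I).

Fixpoint above (p : I) (l : seq I) : tree I (seq I) :=
  if l is x :: l' then
    Vote p x 1 (fun b => bind (above p l') (fun G => Ret (if b then x :: G else G)))
  else Ret [::].

Lemma eval_above p l : eval o (above p l) = filter (o p) l.
Proof. by elim: l => //= x l IH; rewrite eval_bind IH. Qed.

Lemma ncost_above p l : ncost o (above p l) = size l.
Proof. by elim: l => //= x l IH; rewrite ncost_bind IH addn0. Qed.

Fixpoint brute (l : seq I) (i : nat) (cand : seq I) : tree I I :=
  if cand is x :: cand' then
    bind (above x l) (fun G => if size G == i then Ret x else brute l i cand')
  else Ret d.

Fixpoint medians (cs : seq (seq I)) : tree I (seq I) :=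
  if cs is c :: cs' then
    bind (brute c 2 c) (fun x => bind (medians cs') (fun xs => Ret (x :: xs)))
  else Ret [::].

Fixpoint sel (fuel : nat) (l : seq I) (i : nat) : tree I I :=
  if fuel is fuel'.+1 then
    if (size l < 60)%N then brute l i l else
    bind (medians (reshape (nseq (size l %/ 5) 5) l)) (fun ms =>
    bind (sel fuel' ms (size ms)./2) (fun p =>
    bind (above p l) (fun G =>
      if (i < size G)%N then sel fuel' G i
      else if i == size G then Ret p
      else sel fuel' [seq x <- l | (x != p) && (x \notin G)] (i - (size G).+1))))
  else Ret d.

Definition top (k : nat) (l : seq I) : tree I (seq I) :=
  bind (sel (size l) l k) (fun p => above p l).

Variable rk : I -> nat.

(** Ranks count from 0 at the largest element, so this places [y] above [x], matching [o x y], the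
    answer to whether [x] is smaller than [y]. *)
Definition gt (x y : I) := (rk y < rk x)%N.

(** Restricted to a list because the compiled votes are reliable only between elements in memory. *)
Definition agree (l : seq I) :=
  {in l &, forall x y, o x y = gt x y} /\ {in l &, injective rk}.

Lemma sub_agree l l' : {subset l' <= l} -> agree l -> agree l'.
Proof.
move=> s [a b]; split=> x y /s xl /s yl; first exact: a.
exact: b.
Qed.

Lemma filter_o l x : agree l -> x \in l -> filter (o x) l = filter (gt x) l.
Proof. by move=> [a _] xl; apply: eq_in_filter => y yl; exact: a. Qed.

Lemma count_predU1 x (P : pred I) l : uniq l -> x \in l -> ~~ P x ->
  count (predU1 x P) l = (count P l).+1.
Proof.
move=> ul xl nP; have := count_predUI (pred1 x) P l.
rewrite count_uniq_mem // xl add1n (@eq_count _ (predI _ _) pred0).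
  by rewrite count_pred0 addn0 => <-; apply: eq_count.
by move=> z /=; case: eqP => //= ->; exact: negbTE.
Qed.

Lemma count_gt_inj l : uniq l -> agree l ->
  {in l &, injective (fun x => count (gt x) l)}.
Proof.
move=> ul [_ inj] x y xl yl cxy; apply: inj => //.
wlog lt : x y xl yl cxy / (rk x < rk y)%N.
  by move=> H; case: (ltngtP (rk x) (rk y)) => // h; [|symmetry]; exact: H.
have : (count (gt x) l < count (gt y) l)%N; last by rewrite cxy ltnn.
rewrite -(count_predU1 ul xl) ?/gt ?ltnn //.
by apply: sub_count => z /=; rewrite /gt => /orP[/eqP->//|]; lia.
Qed.

(** Pigeonhole: the ranks within [l] are [size l] distinct numbers below [size l], so all of them
    occur. *)
Lemma exists_rank l i : uniq l -> agree l -> (i < size l)%N ->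
  exists2 x, x \in l & count (gt x) l = i.
Proof.
move=> ul ag il.
pose s := [seq count (gt x) l | x <- l].
have us : uniq s by rewrite map_inj_in_uniq //; exact: count_gt_inj.
have ss : {subset s <= iota 0 (size l)}.
  move=> y /mapP[x xl ->]; rewrite mem_iota /= add0n.
  have /= := count_predC (gt x) l => <-.
  rewrite -[X in (X < _)%N]addn0 ltn_add2l -has_count.
  by apply/hasP; exists x => //=; rewrite /gt ltnn.
have ls : (size (iota 0 (size l)) <= size s) by rewrite size_map size_iota.
have [_ eqs] := uniq_min_size us ss ls.
have : i \in s by rewrite eqs mem_iota.
by case/mapP => x xl ->; exists x.
Qed.

Lemma brute_spec l i : uniq l -> agree l -> (i < size l)%N ->
  let x := eval o (brute l i l) in x \in l /\ count (gt x) l = i.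
Proof.
move=> ul ag il /=.
have [x0 x0l x0i] := exists_rank ul ag il.
have main cand : {subset cand <= l} -> x0 \in cand ->
   eval o (brute l i cand) \in l /\ count (gt (eval o (brute l i cand))) l = i.
  elim: cand => //= x cand IH sub xc.
  have xl : x \in l by apply: sub; rewrite inE eqxx.
  rewrite eval_bind eval_above filter_o // size_filter.
  case: eqP => // ne; apply: IH; first by move=> y yc; apply: sub; rewrite inE yc orbT.
  by move: xc; rewrite inE => /orP[/eqP e|//]; rewrite -e x0i in ne.
exact: main.
Qed.

Lemma ncost_brute l i cand : (ncost o (brute l i cand) <= size cand * size l)%N.
Proof.
elim: cand => //= x cand IH; rewrite ncost_bind ncost_above mulSn leq_add2l.
by case: ifP.
Qed.

Definition med (c : seq I) := eval o (brute c 2 c).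

Lemma eval_medians cs : eval o (medians cs) = map med cs.
Proof. by elim: cs => //= c cs IH; rewrite !eval_bind IH. Qed.

Lemma ncost_medians cs : all (fun c => size c == 5) cs ->
  (ncost o (medians cs) <= 25 * size cs)%N.
Proof.
elim: cs => //= c cs IH /andP[/eqP sc /IH {}IH].
rewrite !ncost_bind /= addn0.
have := ncost_brute c 2 c; rewrite sc; lia.
Qed.

Lemma med_spec c : uniq c -> agree c -> size c = 5%N ->
  [/\ med c \in c, count (gt (med c)) c = 2%N
    & (3 <= count (predC (gt (med c))) c)%N].
Proof.
move=> uc ac sc; have [mc cm] : med c \in c /\ count (gt (med c)) c = 2%N.
  by apply: brute_spec; rewrite ?sc.
by split=> //; have := count_predC (gt (med c)) c; rewrite sc cm; lia.
Qed.

(** A group whose median is above [p] has three elements above [p]: the median and the two above it.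
    Otherwise the median and the two below it are not above [p]. *)
Lemma medians_spec cs p : uniq (flatten cs) -> agree (flatten cs) ->
  all (fun c => size c == 5) cs ->
  [/\ {subset map med cs <= flatten cs}, uniq (map med cs),
      (3 * count (gt p) (map med cs) <= count (gt p) (flatten cs))%N
    & (3 * count (predC (gt p)) (map med cs) <= count (predC (gt p)) (flatten cs))%N].
Proof.
elim: cs => //= c cs IH; rewrite cat_uniq => /and3P[uc hc ucs] ag /andP[/eqP sc scs].
have [] := IH ucs (sub_agree _ ag) scs; first by move=> x xc; rewrite mem_cat xc orbT.
move=> sub um c1 c2.
have agc : agree c by apply: sub_agree ag => x xc; rewrite mem_cat xc.
have [mc m2 m3] := med_spec uc agc sc.
split.
- move=> x; rewrite inE mem_cat => /orP[/eqP->|/sub ->]; first by rewrite mc.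
  by rewrite orbT.
- rewrite um andbT; apply/negP => /sub mm.
  by move/hasP: hc; apply; exists (med c).
- rewrite count_cat mulnDr leq_add //; case gm: (gt p _) => //.
  rewrite muln1.
  rewrite -{1}[3]/(2.+1) -{1}m2 -(count_predU1 uc mc) ?/gt ?ltnn //.
  by apply: sub_count => z /=; move: gm; rewrite /gt => gm /orP[/eqP->//|]; lia.
- rewrite count_cat mulnDr leq_add //=; case gm: (gt p _) => //=.
  rewrite muln1; apply: leq_trans m3 _; apply: sub_count => z /=.
  by move: gm; rewrite /gt; lia.
Qed.

Lemma count_gt_above l p x : gt p x ->
  count (gt x) (filter (gt p) l) = count (gt x) l.
Proof.
move=> px; rewrite count_filter; apply: eq_count => y /=.
by move: px; rewrite /gt; lia.
Qed.

Lemma count_gt_below l p x : uniq l -> agree l -> p \in l -> x \in l ->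
  x != p -> ~~ gt p x ->
  count (gt x) l = ((count (gt p) l).+1 +
    count (gt x) (filter (fun y => (y != p) && ~~ gt p y) l))%N.
Proof.
move=> ul [_ inj] pl xl xp px.
have px' : gt x p.
  have : rk x != rk p by apply: contra xp => /eqP /inj ->.
  by move: px; rewrite /gt; lia.
rewrite count_filter -(count_predU1 ul pl) ?/gt ?ltnn // -count_predUI.
rewrite [X in _ + X](@eq_count _ _ pred0) ?count_pred0 ?addn0.
  apply: eq_count => y /=; case: eqP => [->|] //=; rewrite -/(gt _ _).
  by move: px'; rewrite /gt; lia.
by move=> y /=; case: eqP; rewrite ?andbF //=; lia.
Qed.

Lemma reshape_nseq n c l : n * c <= size l ->
  flatten (reshape (nseq n c) l) = take (n * c) l /\
  all (fun s : seq I => size s == c) (reshape (nseq n c) l).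
Proof.
elim: n l => [|n IH] l /=; first by rewrite take0.
rewrite mulSn => nc; have [|fl al] := IH (drop c l); first by rewrite size_drop; lia.
by rewrite takeD fl al size_takel ?eqxx //; lia.
Qed.

Lemma sel_spec fuel l i : (size l <= fuel) -> uniq l -> agree l -> i < size l ->
  [/\ eval o (sel fuel l i) \in l, count (gt (eval o (sel fuel l i))) l = i
    & ncost o (sel fuel l i) <= 120 * size l].
Proof.
elim: fuel l i => [|fuel IH] l i /=; first by lia.
move=> sl ul ag il; case: ifP => l60.
  have [h1 h2] := brute_spec ul ag il; split=> //.
  by have := ncost_brute l i l; nia.
set cs := reshape _ l.
have scs : size cs = size l %/ 5 by rewrite size_reshape size_nseq.
have [|fcs acs] := @reshape_nseq (size l %/ 5) 5 l; first exact: leq_divM.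
rewrite -/cs in fcs acs.
have subcs : {subset flatten cs <= l} by rewrite fcs => x; exact: mem_take.
have ucs : uniq (flatten cs) by rewrite fcs take_uniq.
have mspec p := medians_spec p ucs (sub_agree subcs ag) acs.
have [subm um _ _] := mspec d.
set ms := map med cs in subm um mspec *.
have sms : size ms = size l %/ 5 by rewrite size_map.
have [] := IH ms (size ms)./2 _ um (sub_agree (fun x h => subcs x (subm x h)) ag) _.
- by rewrite sms; lia.
- by rewrite sms; lia.
rewrite !eval_bind !ncost_bind eval_medians -/ms.
set p := eval _ _ => pms pc costp.
have [_ _ cG cL] := mspec p.
have pl : p \in l by apply/subcs/subm.
rewrite ?eval_bind ?ncost_bind eval_above ncost_above filter_o //.
set G := filter (gt p) l.
have sG : size G = count (gt p) l by rewrite size_filter.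
have cG' : 3 * (size ms)./2 <= size G.
  by rewrite -pc sG; apply: leq_trans cG _; rewrite fcs leq_count_subseq ?take_subseq.
have cL' : 3 * (size ms - (size ms)./2) <= size l - size G.
  have -> : size ms - (size ms)./2 = count (predC (gt p)) ms.
    by have := count_predC (gt p) ms; rewrite pc; lia.
  have -> : size l - size G = count (predC (gt p)) l.
    by have := count_predC (gt p) l; rewrite sG; lia.
  by apply: leq_trans cL _; rewrite fcs leq_count_subseq ?take_subseq.
have sGl : size G <= size l by rewrite size_filter count_size.
have costm := ncost_medians acs.
rewrite scs in costm; rewrite sms in cG' cL'.
(* Per element of [l]: 5 votes for the medians, 24 for the pivot, 1 for the split and 84 for the
   remaining 7/10. The 6 spare ones cover the rounding because [l] has at least 60 elements. *)
have arith c s : c <= 120 * s -> s <= size G \/ s <= size l - size G ->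
  ncost o (medians cs) + (ncost o (sel fuel ms (size ms)./2) + (size l + c))
    <= 120 * size l.
  have l60' : 60 <= size l by rewrite leqNgt l60.
  move: costm costp cG' cL' l60' sGl; rewrite sms.
  move: (size G) (size l) (ncost o _) (ncost o _) => g m a b.
  clear; lia.
case: ltngtP => iG.
- have subG : {subset G <= l} by exact: mem_subseq (filter_subseq _ _).
  have [|||h1 h2 h3] := IH G i _ _ _ iG.
  + by lia.
  + exact: filter_uniq.
  + exact: sub_agree ag.
  split; [exact: subG| |by apply: arith h3 _; left].
  by rewrite -(@count_gt_above l p) //; move: h1; rewrite mem_filter => /andP[].
- set Lo := filter _ l.
  have eLo : Lo = [seq y <- l | (y != p) && ~~ gt p y].
    by apply: eq_in_filter => y yl; rewrite mem_filter yl andbT.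
  have sLo : size Lo = size l - (size G).+1.
    have := count_predC (predU1 p (gt p)) l.
    rewrite count_predU1 // ?/gt ?ltnn // -/(gt p) -sG eLo size_filter.
    rewrite (@eq_count _ (predC _) (fun y => (y != p) && ~~ gt p y)); first by lia.
    by move=> y /=; rewrite negb_or.
  have subL : {subset Lo <= l} by exact: mem_subseq (filter_subseq _ _).
  have [||||h1 h2 h3] := IH Lo (i - (size G).+1).
  + by lia.
  + exact: filter_uniq.
  + exact: sub_agree ag.
  + by lia.
  split; [exact: subL| |by apply: arith h3 _; right; rewrite sLo leq_sub2l].
  have inLo x : x \in Lo -> [/\ x \in l, x != p & ~~ gt p x].
    by rewrite eLo mem_filter => /andP[/andP[? ?] ?].
  have [xl xp npx] := inLo _ h1.
  have := @count_gt_below l p _ ul ag pl xl xp npx.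
  by rewrite -eLo h2 -sG => ->; rewrite subnKC.
- split=> //=; first by rewrite -sG.
  by apply: (arith 0 0) => //; left.
Qed.

Lemma top_spec k l : uniq l -> agree l -> k < size l ->
  [/\ subseq (eval o (top k l)) l, size (eval o (top k l)) = k,
     {in l, forall x, count (gt x) l < k -> x \in eval o (top k l)}
   & ncost o (top k l) <= 121 * size l].
Proof.
move=> ul ag kl; rewrite /top eval_bind ncost_bind ncost_above eval_above.
have [pl pc cost] := sel_spec (leqnn _) ul ag kl.
move: (eval _ _) pl pc => p pl pc; rewrite filter_o //; split.
- exact: filter_subseq.
- by rewrite size_filter.
- move=> x xl cx; rewrite mem_filter xl andbT; apply: contraLR cx => npx.
  by rewrite -leqNgt -pc; apply: sub_count => y; move: npx; rewrite /gt; lia.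
- by rewrite -addn1 mulnDl mul1n in cost *; lia.
Qed.

End Selection.

(** * The cascade of champions *)

Section Cascade.
Variable I : eqType.

Definition slots := seq (I * nat).

(** Returns the champion with its health, then the loser. From level 1 a fuel of [g.+1] suffices,
    since each lost vote lowers the health. *)
Fixpoint fight (fuel : nat) (c : I) (g i : nat) (x : I) : tree I (I * nat * I) :=
  if fuel is fuel'.+1 then
    if (g < i)%N then Ret (x, 1%N, c) else
    Vote c x i (fun b =>
      if b then fight fuel' c (g - i) i.+1 x else Ret (c, g.+1, x))
  else Ret (x, 1%N, c).

Fixpoint insert (m : nat) (S : slots) (x : I) : tree I slots :=
  if m is m'.+1 then
    if S is (c, g) :: S' then
      bind (fight g.+1 c g 1 x) (fun w =>
      bind (insert m' S' w.2) (fun S'' => Ret (w.1 :: S'')))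
    else Ret [:: (x, 1%N)]
  else Ret [::].

Fixpoint inserts (m : nat) (S : slots) (X : seq I) : tree I slots :=
  if X is x :: X' then bind (insert m S x) (fun S' => inserts m S' X')
  else Ret S.

Definition health (S : slots) : nat := sumn (map snd S).

(** Twice the health is the potential. A lost vote of level [i] releases [2 * i] units: [i] pay for
    the vote, and the other [i] cover the growth of the level term. When the champion resists, the
    level term pays for the vote and the 2 for the gained health. *)
Lemma mcost_fight (f : I * nat * I -> nat) A fuel c g i x :
  (0 < i)%N -> (forall w, f w <= 2 * w.1.2 + A)%N ->
  (mcost f (fight fuel c g i x) <= 2 * g + i + 2 + A)%N.
Proof.
move=> i0 fA; elim: fuel g i i0 => [|fuel IH] g i i0 /=.
  by apply: leq_trans (fA _) _ => /=; lia.
case: ifP => gi /=; first by apply: leq_trans (fA _) _ => /=; lia.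
have := IH (g - i)%N i.+1 isT; have := fA (c, g.+1, x) => /=; lia.
Qed.

Local Arguments fight : simpl never.

Lemma mcost_insert (f : slots -> nat) A m S x :
  (forall S', f S' <= 2 * health S' + A)%N ->
  (mcost f (insert m S x) <= 2 * health S + 3 * m + A)%N.
Proof.
elim: m S x f A => [|m IH] S x f A fA /=.
  by apply: leq_trans (fA _) _; rewrite /health /=; lia.
case: S => [|[c g] S] /=; first by apply: leq_trans (fA _) _; rewrite /health /=; lia.
rewrite mcost_bind.
apply: leq_trans (mcost_fight (A := (2 * health S + 3 * m + A)%N) _ _ _ _ _ _) _ => //.
  move=> w; rewrite mcost_bind /=.
  apply: leq_trans (IH S w.2 _ (2 * w.1.2 + A)%N _) _; last by lia.
  by move=> S'; apply: leq_trans (fA _) _; rewrite /health /=; lia.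
by rewrite /health /=; lia.
Qed.

Lemma mcost_inserts (f : slots -> nat) A m S X :
  (forall S', f S' <= 2 * health S' + A)%N ->
  (mcost f (inserts m S X) <= 2 * health S + 3 * m * size X + A)%N.
Proof.
elim: X S A => [|x X IH] S A fA /=; first by rewrite muln0 addn0.
rewrite mcost_bind.
apply: leq_trans (@mcost_insert _ (3 * m * size X + A)%N _ _ _ _) _; last by nia.
by move=> S'; apply: leq_trans (IH _ _ fA) _; rewrite addnA.
Qed.

Variables (R : realFieldType) (e th : R) (o : I -> I -> bool) (rk : I -> nat).
Hypotheses (e0 : 0 <= e) (th0 : 0 < th) (th2 : th <= 1 / 2)
  (eth : e <= th ^+ 2 / 2).

(** Risk of a slot without its rightful champion: [2 * e] for the rightful challenger losing one of
    its votes on arrival, [th] for its being dethroned later, from health 1. *)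
Definition kappa := 2 * e + th.

Let bounds : [/\ 0 <= e, e <= 1 / 2, 0 <= th & th <= 1 / 2].
Proof.
have [] : 0 <= e /\ 0 < th by [].
move: (th2) (eth) => h2 h et0 t0; have h1 : th ^+ 2 <= 1 ^+ 2.
  by rewrite lerXn2r ?nnegrE ?ler01 //; lra.
by rewrite expr1n in h1; split; lra.
Qed.

Let e01 : 0 <= e <= 1.
Proof. by have [] := bounds; lra. Qed.

Let th01 : 0 <= th <= 1.
Proof. by have [] := bounds; lra. Qed.

(** [th ^+ g] is a gambler's-ruin bound on the probability that the rightful champion, the one of
    rank [j], is ever dethroned from health [g]. *)
Definition slot_risk (j : nat) (s : I * nat) : R :=
  if rk s.1 == j then th ^+ s.2 else kappa.

Fixpoint risk (j m : nat) (S : slots) : R :=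
  if m is m'.+1 then
    (if S is s :: _ then slot_risk j s else kappa) + risk j.+1 m' (behead S)
  else 0.

Lemma kappa_ge0 : 0 <= kappa.
Proof. by have [] := bounds; rewrite /kappa; lra. Qed.

Lemma slot_risk_ge0 j s : 0 <= slot_risk j s.
Proof.
by rewrite /slot_risk; case: ifP => _; rewrite ?kappa_ge0 ?exprn_ge0 // ltW.
Qed.

Lemma risk_ge0 j m S : 0 <= risk j m S.
Proof.
elim: m j S => //= m IH j [|s S]; rewrite addr_ge0 ?IH ?kappa_ge0 //.
exact: slot_risk_ge0.
Qed.

Lemma slot_risk1 j x : slot_risk j (x, 1%N) <= kappa.
Proof.
by have [] := bounds; rewrite /slot_risk /=; case: ifP => _; rewrite /kappa ?expr1; lra.
Qed.

Lemma risk_le_kappa j m S : all (fun s => s.2 == 1%N) S ->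
  risk j m S <= m%:R * kappa.
Proof.
elim: m j S => [|m IH] j S; first by rewrite mul0r.
rewrite -natr1 mulrDl mul1r addrC /= => aS.
case: S aS => [|[x g] S] /= aS; first by rewrite lerD ?IH.
by case/andP: aS => /eqP /= -> aS; rewrite lerD ?IH ?slot_risk1.
Qed.

Lemma risk_nil j m : risk j m [::] = m%:R * kappa.
Proof.
by elim: m j => [|m IH] j /=; rewrite ?mul0r // IH -natr1 mulrDl mul1r addrC.
Qed.

(* A champion of rank [j] in slot [j] survives a vote of level [i] lost by
   chance [e ^+ i] at the price of [i] units of health, and [e <= th ^+ 2 / 2]
   makes [th ^+ (g.+1 - i)] a supersolution of this recurrence. *)
Lemma th_step g i : (0 < i)%N -> (i <= g)%N ->
  th ^+ g.+1 + e ^+ i * th ^+ ((g - i).+1 - i.+1) <= th ^+ (g.+1 - i).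
Proof.
have [b1 b2 b3 b4] := bounds; case/andP: th01 => t0 t1 i0 ig; have b5 := eth.
have h1 : th ^+ g.+1 <= th ^+ (g.+1 - i) * (1 / 2).
  rewrite -{1}(subnK (leqW ig)) exprD ler_wpM2l ?exprn_ge0 //.
  apply: le_trans b4; case: i i0 {ig} => // i _.
  by rewrite exprS ler_piMr ?exprn_ile1.
have h2 : e ^+ i <= th ^+ i.*2 / 2.
  apply: le_trans (_ : (th ^+ 2 / 2) ^+ i <= _).
    by rewrite lerXn2r ?nnegrE ?divr_ge0 ?exprn_ge0.
  rewrite exprMn -exprM mul2n ler_wpM2l ?exprn_ge0 //.
  case: i i0 {ig h1} => // i _; rewrite exprS.
  have : (2^-1 : R) ^+ i <= 1 by rewrite exprn_ile1 //; lra.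
  lra.
have h3 : th ^+ i.*2 * th ^+ ((g - i).+1 - i.+1) <= th ^+ (g.+1 - i).
  rewrite -exprD ler_wiXn2l //; move: i0 ig; clear; lia.
have : e ^+ i * th ^+ ((g - i).+1 - i.+1) <= th ^+ i.*2 / 2 * th ^+ ((g - i).+1 - i.+1).
  by rewrite ler_wpM2r ?exprn_ge0.
lra.
Qed.

(** The slot risk is a supermartingale over a challenge. A loser of rank [j] is a failure, for which
    only the bound 1 on [F] is available. *)
Lemma wp_fight (F : I * nat * I -> R) j A c g x :
  o c x = (rk x < rk c)%N -> rk x != rk c -> (j <= rk c)%N -> (j <= rk x)%N ->
  0 <= A -> (forall w, F w <= 1) ->
  (forall s y, (s.1 == c) && (y == x) || (s.1 == x) && (y == c) ->
     rk y != j -> F (s, y) <= slot_risk j s + A) ->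
  wp e o F (fight g.+1 c g 1 x) <= slot_risk j (c, g) + A.
Proof.
have [b1 b2 b3 b4] := bounds; move=> ocx xc jc jx A0 F1 FA; rewrite /slot_risk /=.
case: (eqVneq (rk c) j) => [cj|cj].
  (* Rightful champion: the recurrence is [th_step]. The exponent is [g] at level 1 and vanishes
     exactly when the champion falls, that is when [g' < i]. *)
  suff main fuel i g' : (g' < fuel)%N -> (0 < i)%N ->
    wp e o F (fight fuel c g' i x) <= th ^+ (g'.+1 - i) + A.
    by have := main g.+1 1%N g (leqnn _) isT; rewrite subn1.
  elim: fuel g' i => [|fuel IH] // g' i gf i0.
  rewrite /fight -/fight; case: ifP => gi.
    have /eqP -> : (g'.+1 - i == 0)%N by rewrite subn_eq0.
    by rewrite expr0; apply: le_trans (F1 _) _; rewrite lerDl.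
  have ig : (i <= g')%N by rewrite leqNgt gi.
  apply: le_trans (wp_Vote_le e01 _ (a := th ^+ g'.+1)
    (b := th ^+ ((g' - i).+1 - i.+1)) (A := A) _ _ _ _) _; rewrite ?exprn_ge0 //.
  - rewrite ocx cj ltnNge jx /=.
    apply: le_trans (FA _ _ _ _) _; rewrite ?eqxx -?cj //.
    by rewrite /slot_risk /= cj eqxx.
  - rewrite ocx cj ltnNge jx /=.
    by apply: IH => //; move: gf ig i0; clear; lia.
  - by rewrite lerD2r th_step.
case: (eqVneq (rk x) j) => [xj|xj].
  have xlc : (rk x < rk c)%N by rewrite ltn_neqAle xc xj.
  (* Rightful challenger: the errors from level [i] on sum to at most [2 * e ^+ i] since
     [e <= 1 / 2], and its victory leaves the risk [th]. *)
  suff main fuel i g' : (0 < i)%N ->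
    wp e o F (fight fuel c g' i x) <= (th + 2 * e ^+ i) + A.
    apply: le_trans (main _ 1%N _ isT) _; rewrite /kappa expr1; lra.
  have win i' : F (x, 1%N, c) <= (th + 2 * e ^+ i') + A.
    apply: le_trans (FA _ _ _ _) _; rewrite ?eqxx ?orbT //.
    rewrite /slot_risk /= xj eqxx expr1 lerD2r lerDl mulr_ge0 //.
    exact: exprn_ge0.
  elim: fuel g' i => [|fuel IH] // g' i i0.
  rewrite /fight -/fight; case: ifP => gi; first exact: (win i).
  apply: le_trans (wp_Vote_le e01 _ (a := th + 2 * e ^+ i.+1) (b := 1)
    (A := A) _ _ _ _) _ => //.
  - by rewrite addr_ge0 ?mulr_ge0 ?exprn_ge0 //; lra.
  - by rewrite ocx xlc; exact: IH.
  - rewrite ocx xlc /=.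
    by apply: le_trans (F1 _) _; rewrite lerDl.
  - rewrite exprS; have := exprn_ge0 i e0; move: (e ^+ i) => E E0.
    by rewrite lerD2r; nra.
(* Neither contender has rank [j], so every outcome leaves a slot risk of at most [kappa]. *)
suff main fuel i g' : wp e o F (fight fuel c g' i x) <= kappa + A by exact: main.
have win : F (x, 1%N, c) <= kappa + A.
  apply: le_trans (FA _ _ _ _) _; rewrite ?eqxx ?orbT //.
  by rewrite lerD2r slot_risk1.
have lose g'' : F (c, g'', x) <= kappa + A.
  apply: le_trans (FA _ _ _ _) _; rewrite ?eqxx //.
  by rewrite lerD2r /slot_risk /= (negbTE cj).
elim: fuel g' i => [|fuel IH] // g' i.
rewrite /fight -/fight; case: ifP => gi //.
apply: le_trans (wp_Vote_le e01 _ (a := 0) (b := 0) (A := kappa + A) _ _ _ _) _ => //.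
- by rewrite add0r; case: (o c x) => /=; [exact: IH|exact: lose].
- by rewrite add0r; case: (o c x) => /=; [exact: lose|exact: IH].
- by rewrite mulr0 !add0r.
Qed.

(* No element sits above its rank, whence nothing of rank below [j + m] can
   have dropped out of the slots [j, ..., j + m - 1]. *)
Fixpoint ranked (j : nat) (S : slots) : bool :=
  if S is s :: S' then (j <= rk s.1)%N && ranked j.+1 S' else true.

Definition keeps (k : nat) (D : seq I) (S : slots) : bool :=
  all (fun x => (rk x < k)%N ==> (x \in unzip1 S)) D.

Definition sound (j m : nat) (D : seq I) (S : slots) : bool :=
  [&& ranked j S, (size S <= m)%N, uniq (unzip1 S),
      all (mem D) (unzip1 S) & keeps (j + m) D S].

(** The expected risk does not grow, and no error term is paid per insertion, which makes the final
    bound independent of the length of the stream. Slots are treated one by one, the risk of the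
    others being part of the constant [A]; unless the run has failed, the loser of slot [j] has rank
    above [j], as the next slot requires. *)
Lemma wp_insert (f : slots -> R) A j m S x :
  agree o rk (x :: unzip1 S) -> uniq (x :: unzip1 S) ->
  ranked j S -> (size S <= m)%N -> (j <= rk x)%N ->
  0 <= A -> (forall S', f S' <= 1) ->
  (forall S', sound j m (x :: unzip1 S) S' -> f S' <= risk j m S' + A) ->
  wp e o f (insert m S x) <= risk j m S + A.
Proof.
elim: m j S x f A => [|m IH] j S x f A ag uS rS sS jx A0 f1 fA /=.
  case: S sS ag uS rS fA => // _ _ _ _ fA; rewrite add0r.
  apply: le_trans (fA _ _) _; last by rewrite add0r.
  by rewrite /sound /keeps /= addn0 andbT implybF -leqNgt jx.
case: S sS ag uS rS fA => [|[c g] S] /=.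
  move=> _ _ _ _ fA; apply: le_trans (fA _ _) _.
    by rewrite /sound /keeps /= jx !inE eqxx implybT.
  by rewrite /= lerD2r lerD2r slot_risk1.
move=> sS ag /= /and3P[xcS cS uS] /andP[jc rS] fA.
rewrite wp_bind -addrA.
have xc : rk x != rk c.
  apply/eqP => /(proj2 ag) xc; move: xcS; rewrite inE xc ?eqxx //.
    by rewrite inE eqxx.
  by rewrite !inE eqxx orbT.
apply: wp_fight => //.
- by apply: (proj1 ag); rewrite !inE eqxx ?orbT.
- by rewrite addr_ge0 ?risk_ge0.
- by move=> w; rewrite wp_bind; apply: wp_le_const => // S''; exact: f1.
move=> s y sy yj.
have sub : {subset y :: unzip1 S <= x :: c :: unzip1 S}.
  move=> z; rewrite !inE => /orP[/eqP ->|->]; rewrite ?orbT //.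
  by case/orP: sy => /andP[_ /eqP ->]; rewrite eqxx ?orbT.
have jy : (j <= rk y)%N by case/orP: sy => /andP[_ /eqP ->].
rewrite wp_bind addrCA; apply: IH => //=.
- exact: sub_agree ag.
- move: xcS; rewrite inE negb_or uS andbT => /andP[_ xS].
  by case/orP: sy => /andP[_ /eqP ->].
- by rewrite ltn_neqAle eq_sym yj.
- by rewrite addr_ge0 ?slot_risk_ge0.
move=> S'' /and5P[r1 r2 r3 r4 r5].
rewrite [X in _ <= X]addrA [X in _ <= X + _]addrC.
apply: le_trans (fA (s :: S'') _) _; last by rewrite /=.
have js : (j <= rk s.1)%N by case/orP: sy => /andP[/eqP -> _].
have sD : s.1 \in x :: c :: unzip1 S.
  by case/orP: sy => /andP[/eqP -> _]; rewrite !inE eqxx ?orbT.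
have sN : s.1 \notin y :: unzip1 S.
  move: xcS; rewrite !inE !negb_or => /andP[nxc xS].
  case/orP: sy => /andP[/eqP -> /eqP ->]; first by rewrite eq_sym nxc.
  by rewrite nxc.
apply/and5P; split.
- by rewrite /= js.
- exact: r2.
- by rewrite /= r3 andbT; apply: contra sN => /(allP r4).
- by apply/allP => z; rewrite inE => /orP[/eqP ->|/(allP r4) /sub].
- apply/allP => z zD; apply/implyP => zk; rewrite inE.
  case: (eqVneq z s.1) => //= zs; apply: (implyP (allP r5 z _)); last by rewrite addSnnS.
  move: zD zs; rewrite !inE => /or3P[/eqP->|/eqP->|->]; rewrite ?orbT //.
    by case/orP: sy => /andP[/eqP -> /eqP ->]; rewrite eqxx.
  by case/orP: sy => /andP[/eqP -> /eqP ->]; rewrite eqxx.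
Qed.

Lemma wp_inserts (f : slots -> R) A m S X :
  agree o rk (X ++ unzip1 S) -> uniq (X ++ unzip1 S) ->
  ranked 0 S -> (size S <= m)%N ->
  0 <= A -> (forall S', f S' <= 1) ->
  (forall S', sound 0 m (X ++ unzip1 S) S' -> f S' <= risk 0 m S' + A) ->
  wp e o f (inserts m S X) <= risk 0 m S + A.
Proof.
elim: X S => [|x X IH] S ag uX rS sS A0 f1 fA /=.
  apply: fA; rewrite /sound rS sS uX /=; apply/andP; split; apply/allP => z //=.
  by move=> ->; rewrite implybT.
rewrite wp_bind.
have subS : {subset x :: unzip1 S <= (x :: X) ++ unzip1 S}.
  by move=> z; rewrite !inE mem_cat => /orP[->|->]; rewrite ?orbT.
move: (uX); rewrite /= mem_cat negb_or cat_uniq => /andP[/andP[xX xS] /and3P[u1 u2 u3]].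
apply: wp_insert => //=; rewrite ?xS //.
- exact: sub_agree ag.
- by move=> S'; apply: wp_le_const.
move=> S' /and5P[r1 r2 r3 r4 r5].
have sub : {subset X ++ unzip1 S' <= (x :: X) ++ unzip1 S}.
  move=> z; rewrite mem_cat => /orP[zX|/(allP r4)/subS//].
  by rewrite mem_cat inE zX orbT.
apply: IH => //.
- exact: sub_agree ag.
- rewrite cat_uniq u1 r3 andbT; apply/hasPn => z /(allP r4); rewrite /= inE.
  by case/orP => [/eqP -> //|/(hasPn u2)].
move=> S'' /and5P[q1 q2 q3 q4 q5]; apply: fA.
apply/and5P; split=> //; first by apply/allP => z /(allP q4) /sub.
apply/allP => z zD; apply/implyP => zk.
apply: (implyP (allP q5 z _)) => //.
move: zD; rewrite mem_cat inE -orbA => /or3P[zx|zX|zS].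
- rewrite mem_cat (implyP (allP r5 z _)) ?orbT //; by rewrite inE zx.
- by rewrite mem_cat zX.
- rewrite mem_cat (implyP (allP r5 z _)) ?orbT //; by rewrite inE zS orbT.
Qed.

End Cascade.

(** * One step of the streaming algorithm *)

Section Step.
Variables (I : eqType) (k N : nat).

Definition state := (seq I * slots I)%type.

(** Truncation and the final test enforce the cost and size bounds whatever the answers; when all
    votes are right they change nothing. *)
Definition prune (d : I) (B : seq I) : tree I (seq I) :=
  if (size B <= k)%N then Ret B else
  bind (limit (121 * size B) [::] (top d k B)) (fun G =>
    Ret (if subseq G B && (size G <= k)%N then G else [::])).

Definition block_end (q : nat) : bool := (k ^ 2 %| q.+1)%N || (q.+1 == N).

(* With a single block the cascade, which costs [k ^ 2] votes, is too expensive and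
   useless. *)
Definition direct : bool := (N <= k ^ 2)%N.

Definition finish (q : nat) (S : slots I) (X : seq I) : tree I state :=
  if block_end q then
    bind (if direct then Ret [seq (x, 1%N) | x <- X] else inserts k S X)
      (fun S' => Ret ([::], S'))
  else Ret (X, S).

Definition step (q : nat) (st : state) (p : I) : tree I state :=
  let B := rcons st.1 p in
  bind (if block_end q || (2 * k <= size B)%N then prune p B else Ret B)
    (finish q st.2).

(* Bounds the cost of the votes from step [q] on: 246 votes per buffered element
   pay for a pruning, and [3 * k ^ 2] votes for the [k] insertions that end a block. *)
Definition charge (q : nat) (st : state) : nat :=
  (249 * (N - q) + 246 * size st.1 + 2 * health st.2 +
   (if direct then 0 else 3 * (q %% k ^ 2) + (q < N)%N * (3 * k ^ 2)))%N.

Lemma mcost_prune (f : seq I -> nat) A d B :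
  (forall X, (size X <= size B)%N -> ((size X <= k)%N) -> (f X <= A)%N) ->
  (mcost f (prune d B) <= 121 * size B + A)%N.
Proof.
move=> fA; rewrite /prune; case: ifP => sB /=.
  by rewrite (leq_trans (fA _ _ _)) // leq_addl.
rewrite mcost_bind; apply: mcost_limit => G /=.
case: ifP => [/andP[/size_subseq h1 h2]|_]; exact: fA.
Qed.

Lemma modnS_le q L : (q.+1 %% L <= (q %% L).+1)%N.
Proof. by rewrite -addn1 -modnDml addn1 leq_mod. Qed.

Lemma modn_end q L : (0 < L)%N -> (L %| q.+1)%N -> (L <= (q %% L).+1)%N.
Proof.
move=> L0; rewrite /dvdn -addn1 -modnDml addn1 => h.
by apply: dvdn_leq.
Qed.

(** The 246 units left pay for buffering the arriving element, and 244 units per element of an ended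
    block for its pruning; direct storage spends the other 2 on health. The insertions of a full
    block are paid by the 3 units saved at each of its steps, those of a shorter last block by the
    reserve [3 * k ^ 2]. *)
Lemma mcost_finish (f : state -> nat) q S X :
  (0 < k)%N -> (q < N)%N -> (forall st, f st <= charge q.+1 st)%N ->
  (~~ block_end q || (size X <= k)%N) ->
  (mcost f (finish q S X) + 246 + block_end q * (244 * size X)
    <= charge q (X, S))%N.
Proof.
move=> k0 qN fc; rewrite /finish; case: ifP => le /= sX; last first.
  have := fc (X, S); rewrite /charge /=.
  have := modnS_le q (k ^ 2); move: (k ^ 2)%N => L.
  by case: direct; rewrite ?qN /=; case: (ltnP q.+1 N) => /=; lia.
rewrite mcost_bind /=; case: ifP => dir /=.
  have := fc ([::], [seq (x, 1%N) | x <- X]); rewrite /charge /= dir.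
  have -> : health [seq (x, 1%N) | x <- X] = size X.
    by rewrite /health; elim: (X) => //= x X' ->.
  lia.
set r := (3 * (q.+1 %% k ^ 2) + (q.+1 < N)%N * (3 * k ^ 2))%N.
have fA S' : (f ([::], S') <= 2 * health S' + (249 * (N - q.+1) + r))%N.
  by apply: leq_trans (fc _) _; rewrite /charge /= dir -/r; lia.
have := mcost_inserts k S X fA.
rewrite /charge /= dir qN mul1n.
have : (3 * k * size X <= 3 * k ^ 2)%N by rewrite expnS expn1; nia.
suff : (r + 3 * k ^ 2 <= 3 * (q %% k ^ 2) + 3 * k ^ 2 + 3)%N.
  move: (k ^ 2)%N (mcost _ _) (q %% _)%N => L c m; lia.
rewrite /r; have k2 : (0 < k ^ 2)%N by rewrite expn_gt0 k0.
have := modnS_le q (k ^ 2).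
move: le; rewrite /block_end; case: (boolP (k ^ 2 %| q.+1)%N) => [dv _|_ /= /eqP eN].
  move: (modn_end k2 dv); move: dv; rewrite /dvdn; move: (k ^ 2)%N => L /eqP -> h.
  by case: (q.+1 < N)%N; lia.
by rewrite eN ltnn; lia.
Qed.

(** A pruning at size [2 * k] or more drops at least half of the buffer and so releases at least 123
    units per element; a block end releases at least 244. Both exceed the 121 votes per element of
    [prune]. *)
Lemma mcost_step (f : state -> nat) q st p :
  (0 < k)%N -> (q < N)%N -> (forall st', f st' <= charge q.+1 st')%N ->
  (mcost f (step q st p) <= charge q st)%N.
Proof.
move=> k0 qN fc; rewrite /step mcost_bind.
have sB : size (rcons st.1 p) = (size st.1).+1 by rewrite size_rcons.
have cB X : (charge q (X, st.2) + 246 * size st.1 = charge q st + 246 * size X)%N.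
  by rewrite /charge /=; lia.
have keep : ~~ block_end q || (size (rcons st.1 p) <= k)%N ->
    (mcost f (finish q st.2 (rcons st.1 p)) <= charge q st)%N.
  move=> h; have := mcost_finish st.2 k0 qN fc h; have := cB (rcons st.1 p); lia.
case: ifP => [h|/norP[h1 h2]] /=; last by apply: keep; rewrite h1.
case: (leqP (size (rcons st.1 p)) k) => sk.
  by rewrite /prune sk; apply: keep; rewrite sk orbT.
apply: leq_trans (mcost_prune (A := charge q st - 121 * size (rcons st.1 p)) _ _) _.
  move=> X Xs Xk; have := mcost_finish st.2 (X := X) k0 qN fc.
  rewrite Xk orbT => /(_ isT); have := cB X.
  move: (mcost _ _) (charge _ _) (charge _ _) (Xs) (Xk) h => a b c.
  by rewrite sB; case: (block_end q) => /=; lia.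
rewrite subnKC //; rewrite /charge sB.
move: (if direct then _ else _) (health _) => a b; lia.
Qed.

(** Up to [k] elements are kept without any vote. This serves the case [k = 1] with [delta] close to
    1, where the budget can be below one comparison. *)
Lemma mcost_small (f : state -> nat) q B p :
  (N <= k)%N -> (q < N)%N -> (size B <= q)%N -> (0 < k)%N ->
  (forall st, (size st.1 <= q.+1)%N -> ((q.+1 < N)%N -> st.2 = [::]) -> f st = 0%N) ->
  mcost f (step q (B, [::]) p) = 0%N.
Proof.
move=> Nk qN Bq k0 f0; rewrite /step mcost_bind /=.
have sB : (size (rcons B p) <= k)%N by rewrite size_rcons; lia.
rewrite /prune sB if_same /= /finish; case: ifP => /= [le|_]; last first.
  by apply: f0; rewrite // size_rcons.
have Nk2 : (N <= k ^ 2)%N by rewrite expnS expn1; nia.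
rewrite mcost_bind /direct Nk2 /=; apply: f0 => //= q1N.
move: le; rewrite /block_end ltn_eqF // orbF => /dvdn_leq; lia.
Qed.

End Step.

(** * Critical steps and the failure potential *)

Lemma leq_count_block (L q n : nat) : (0 < L)%N ->
  (count (fun i => (i %/ L)%N == q) (iota 0 n) <= L)%N.
Proof.
move=> L0; rewrite -size_filter.
suff : (size [seq i <- iota 0 n | (i %/ L)%N == q] <= size (iota (q * L) L))%N.
  by rewrite size_iota.
apply: uniq_leq_size; first by rewrite filter_uniq ?iota_uniq.
move=> i; rewrite mem_filter !mem_iota => /andP[/eqP <- _].
by rewrite leq_divM /=; have := ltn_ceil i L0; rewrite mulSn addnC.
Qed.

Lemma leq_count_has (I J : Type) (P : I -> J -> bool) (A : seq I) (B : seq J) L :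
  (forall b, count (fun a => P a b) A <= L)%N ->
  (count (fun a => has (P a) B) A <= size B * L)%N.
Proof.
move=> PL; elim: B => [|b B IH] /=; first by rewrite count_pred0.
rewrite mulSn; apply: leq_trans (leq_add (PL b) IH).
by rewrite -count_predUI; apply: leq_trans (leq_addr _ _); apply: sub_count.
Qed.

Section Loss.
Variables (I : eqType) (k : nat) (ps : seq I) (rk : I -> nat).
Variables (R : realFieldType) (e th : R).
Hypotheses (k0 : (0 < k)%N) (ups : uniq ps) (rk_inj : {in ps &, injective rk}).
Hypotheses (e0 : 0 <= e) (th0 : 0 < th) (th2 : th <= 1 / 2)
  (eth : e <= th ^+ 2 / 2).

Let N := size ps.
Let L := (k ^ 2)%N.

Definition topmost : seq I := [seq x <- ps | (rk x < k)%N].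

(* Errors are harmless while the current block has no element of the top. *)
Definition critical (q : nat) : bool :=
  has (fun x => (q %/ L)%N == (index x ps %/ L)%N) topmost.

Definition criticals (q : nat) : nat := count critical (iota q (N - q)%N).

Lemma size_topmost : (size topmost <= k)%N.
Proof.
rewrite -(size_map rk) -[leqRHS](size_iota 0); apply: uniq_leq_size.
  rewrite map_inj_in_uniq ?filter_uniq // => x y; rewrite !mem_filter.
  by move=> /andP[_ xs] /andP[_ ys]; exact: rk_inj.
by move=> _ /mapP[x + ->]; rewrite mem_filter mem_iota => /andP[].
Qed.

Lemma leq_criticals : (criticals 0 <= k ^ 3)%N.
Proof.
apply: (@leq_trans (size topmost * L)).
  by apply: leq_count_has => x; apply: leq_count_block; rewrite expn_gt0 k0.
by rewrite expnS leq_mul2r size_topmost orbT.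
Qed.

(** States without a fatal error: every arrived element of rank below [k] in the whole of [ps] is
    still stored. The buffer is confined to the current block, hence holds none of them at a
    non-critical step. *)
Definition valid (q : nat) (st : state I) : bool :=
  [&& uniq (st.1 ++ unzip1 st.2), all (mem (take q ps)) (st.1 ++ unzip1 st.2),
      all (fun x => (rk x < k)%N ==> (x \in st.1 ++ unzip1 st.2)) (take q ps),
      all (fun x => (index x ps %/ L)%N == (q %/ L)%N) st.1,
      (size st.1 < 2 * k)%N, (size st.2 <= k)%N &
      ((q == N) ==> nilp st.1) &&
      (if direct k N then (q < N)%N ==> nilp st.2 else ranked rk 0 st.2)].

(** Union bound for one pruning: 121 votes for each of at most [2 * k] elements. *)
Definition prune_risk : R := (242 * k)%:R * e.

Definition bound (q : nat) (st : state I) : R :=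
  risk e th rk 0 k st.2 + prune_risk * (criticals q)%:R.

(** Potential bounding the probability of failure from this state on; it is 1 after a fatal
    error. *)
Definition loss (q : nat) (st : state I) : R :=
  if valid q st then Num.min 1 (bound q st) else 1.

Lemma prune_risk_ge0 : 0 <= prune_risk.
Proof. by rewrite mulr_ge0. Qed.

Lemma bound_ge0 q st : 0 <= bound q st.
Proof. by rewrite addr_ge0 ?risk_ge0 ?mulr_ge0 ?prune_risk_ge0. Qed.

Lemma loss_ge0 q st : 0 <= loss q st.
Proof. by rewrite /loss; case: ifP => // _; rewrite le_min ler01 bound_ge0. Qed.

Lemma loss_le1 q st : loss q st <= 1.
Proof. by rewrite /loss; case: ifP => // _; rewrite ge_min lexx. Qed.

Lemma loss_le_bound q st : valid q st -> loss q st <= bound q st.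
Proof. by rewrite /loss => ->; rewrite ge_min lexx orbT. Qed.

Let e01 : 0 <= e <= 1.
Proof.
have [] : 0 <= e /\ 0 < th by [].
move: (th2) (eth) => h2 h et0 t0; have h1 : th ^+ 2 <= 1 ^+ 2.
  by rewrite lerXn2r ?nnegrE ?ler01 //; lra.
by rewrite expr1n in h1; lra.
Qed.

Variables (o : I -> I -> bool) (q : nat) (B : seq I) (S : slots I) (p : I).
Hypotheses (qN : (q < N)%N) (def_p : p = nth p ps q).
Hypothesis (v : valid q (B, S)).
Let D := rcons B p ++ unzip1 S.
Hypothesis (ag : agree o rk D).
Variable f : state I -> R.
Hypotheses (f0 : forall st, 0 <= f st) (f1 : forall st, f st <= 1).
Hypothesis f_bound : forall st,
  valid q.+1 st -> {subset st.1 ++ unzip1 st.2 <= D} -> f st <= bound q.+1 st.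

Let L0 : (0 < L)%N. Proof. by rewrite expn_gt0 k0. Qed.

Let takeS : take q.+1 ps = rcons (take q ps) p.
Proof. by rewrite (take_nth p) // -def_p. Qed.

Let uD : uniq D.
Proof.
case/and3P: v => uBS /allP sBS _; rewrite /D cat_rcons -cat1s uniq_catCA /= uBS andbT.
apply/negP => /sBS /= pq.
by have := take_uniq q.+1 ups; rewrite takeS rcons_uniq pq.
Qed.

Let index_p : index p ps = q.
Proof. by rewrite def_p index_uniq. Qed.

Let end_direct : block_end k N q -> direct k N -> q.+1 = N.
Proof.
rewrite /block_end /direct => /orP[/dvdn_leq h|/eqP//] NL.
by apply/eqP; rewrite eqn_leq qN /=; apply: leq_trans NL (h _).
Qed.

Let top_D x : x \in take q.+1 ps -> (rk x < k)%N -> x \in D.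
Proof.
rewrite takeS mem_rcons inE /D cat_rcons mem_cat inE.
move=> /orP[->|xq xk]; first by rewrite orbT.
case/and3P: v => _ _ /andP[/allP/(_ x xq)]; rewrite xk mem_cat /= => /orP[->|->] //.
by rewrite !orbT.
Qed.

Lemma wp_finish X : {subset X <= rcons B p} -> uniq X ->
  {in rcons B p, forall x, (rk x < k)%N -> x \in X} ->
  (size X <= k)%N || ~~ block_end k N q && (size X < 2 * k)%N ->
  wp e o f (finish k N q S X) <= risk e th rk 0 k S + prune_risk * (criticals q.+1)%:R.
Proof.
move=> XB uX topX sX; rewrite /finish.
have subD : {subset X ++ unzip1 S <= D}.
  by move=> x; rewrite !mem_cat => /orP[/XB ->|->]; rewrite ?orbT.
have DT : {subset D <= take q.+1 ps}.
  case/and3P: v => _ /allP sBS _ x; rewrite takeS /D cat_rcons mem_rcons mem_cat !inE.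
  move=> /or3P[xB|->//|xS]; apply/orP; right; apply: sBS.
    by rewrite mem_cat xB.
  by rewrite mem_cat xS orbT.
have uXS : uniq (X ++ unzip1 S).
  move: uD; rewrite /D !cat_uniq uX => /and3P[_ /hasPn BS ->].
  by rewrite andbT; apply/hasPn => x /BS; apply: contra => /XB.
have topXS x : x \in take q.+1 ps -> (rk x < k)%N -> x \in X ++ unzip1 S.
  move=> xq xk; have := top_D xq xk; rewrite /D !mem_cat => /orP[xB|->].
    by rewrite topX.
  by rewrite orbT.
case/and5P: (v) => v1 v2 v3 v4 /and4P[/= v5 v6 _ v7].
case: ifP => le; last first.
  apply: f_bound => //=; apply/and5P; split => //=.
  - by apply/allP => x /subD /DT.
  - by apply/allP => x xq; apply/implyP => xk; exact: topXS.
  - have dL : (k ^ 2 %| q.+1)%N = false by case/norP: (negbT le) => /negbTE.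
    apply/allP => x /XB; rewrite divnS // dL add0n mem_rcons inE => /orP[/eqP->|xB].
      by rewrite index_p.
    exact: (allP v4).
  rewrite v6 /=; apply/and3P; split; last first.
  - by move: v7; case: ifP => // _; rewrite qN /= => ->; rewrite implybT.
  - by case/norP: (negbT le) => _ /negbTE ->.
  - case/orP: sX => [sX|/andP[]//]; apply: leq_ltn_trans sX _.
    by rewrite mul2n -addnn -[X in (X < _)%N]addn0 ltn_add2l.
have {}sX : (size X <= k)%N by case/orP: sX => //; rewrite le.
rewrite wp_bind /=; case: ifP => dir.
  have qN1 := end_direct le dir.
  move: v7; rewrite dir qN /= => /nilP S0.
  have uz : unzip1 [seq (x, 1%N) | x <- X] = X by rewrite /unzip1 -map_comp map_id_in.
  have vN : valid q.+1 ([::], [seq (x, 1%N) | x <- X]).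
    rewrite /valid /= uz uX dir qN1 ltnn size_map sX /= muln_gt0 k0 /= implybT !andbT.
    rewrite -qN1; apply/andP; split.
      by apply/allP => x xX; apply/DT/subD; rewrite mem_cat xX.
    apply/allP => x xq; apply/implyP => xk.
    by have := topXS x xq xk; rewrite S0 cats0.
  apply: le_trans (f_bound vN _) _.
    by move=> x; rewrite /= uz => xX; apply: subD; rewrite mem_cat xX.
  (* Slots of health 1 are no riskier than the empty slots they replace, charged [kappa] each. *)
  rewrite /bound lerD2r S0 risk_nil; apply: risk_le_kappa => //.
  by apply/allP => _ /mapP[x _ ->].
apply: (wp_inserts (rk := rk)) => //.
- exact: sub_agree ag.
- by move: v7; rewrite dir.
- by rewrite mulr_ge0 ?prune_risk_ge0.
move=> S' /and5P[r1 r2 r3 r4 r5]; apply: f_bound => /=.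
  rewrite /valid /= r3 r2 dir r1 muln_gt0 k0 /= implybT !andbT; apply/andP; split.
    by apply/allP => x /(allP r4) /subD /DT.
  apply/allP => x xq; apply/implyP => xk.
  by apply: (implyP (allP r5 x _)) => //; exact: topXS.
by move=> x /(allP r4) /subD.
Qed.

Lemma critical_now : criticals q = (critical q + criticals q.+1)%N.
Proof. by rewrite /criticals -(subnSK qN). Qed.

Lemma wp_step : wp e o f (step k N q (B, S) p) <= bound q (B, S).
Proof.
rewrite /bound /step wp_bind /=.
have uB : uniq (rcons B p) by move: uD; rewrite /D cat_uniq => /andP[].
have le_next : risk e th rk 0 k S + prune_risk * (criticals q.+1)%:R <=
    risk e th rk 0 k S + prune_risk * (criticals q)%:R.
  by rewrite lerD2l ler_wpM2l ?prune_risk_ge0 // ler_nat critical_now leq_addl.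
have sB : (size B < 2 * k)%N by case/and5P: v => _ _ _ _ /andP[].
case: ifP => [_|/norP[nle s2k]] /=; last first.
  apply: le_trans le_next; apply: wp_finish => //.
  by rewrite nle ltnNge s2k orbT.
rewrite /prune; case: ifP => [sk|/negbT] /=.
  by apply: le_trans le_next; apply: wp_finish => //; rewrite sk.
rewrite -ltnNge => sk.
have agB : agree o rk (rcons B p).
  by apply: sub_agree ag => x xB; rewrite /D mem_cat xB.
have [t1 t2 t3 t4] := top_spec p uB agB sk.
rewrite wp_bind.
(* At a critical step the union bound costs one [prune_risk], paid by the drop of [criticals]. *)
case: (boolP (critical q)) => cq.
  apply: le_trans (wp_limit e01 _ _ _) _ => //.
    by move=> X /=; rewrite wp_ge0 // wp_le_const.
  rewrite /= t1 t2 leqnn /= critical_now cq natrD mulrDr mulr1 addrCA addrC.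
  apply: lerD.
    apply: wp_finish => //; rewrite ?t2 ?leqnn //.
    - exact: mem_subseq.
    - exact: subseq_uniq t1 _.
    (* The elements of the buffer above [x] have distinct ranks below [rk x], so there are fewer
       than [k] of them. *)
    - move=> x xB xk; apply: t3 => //; apply: leq_ltn_trans xk.
      rewrite -size_filter -(size_map rk) -[leqRHS](size_iota 0).
      apply: uniq_leq_size.
        rewrite map_inj_in_uniq ?filter_uniq // => y z; rewrite !mem_filter.
        by move=> /andP[_ yB] /andP[_ zB]; apply: (proj2 agB).
      move=> _ /mapP[y + ->]; rewrite mem_filter mem_iota /gt => /andP[] //.
  rewrite /prune_risk ler_wpM2r // ler_nat size_rcons.
  by rewrite (_ : 242 = 121 * 2)%N // -mulnA leq_mul2l.
(* Without a topmost element in the buffer, any outcome of the pruning leaves a valid state. *)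
apply: le_trans le_next; apply: wp_le_const => // G /=.
case/and5P: (v) => v1 v2 v3 v4 _.
have noTop x : x \in rcons B p -> (rk x < k)%N -> False.
  move=> xB xk; move/hasP: cq; apply; exists x.
    rewrite mem_filter xk /=; apply: (mem_take (n0 := q.+1)).
    rewrite takeS mem_rcons inE; move: xB; rewrite mem_rcons inE => /orP[->//|xB].
    by apply/orP; right; apply: (allP v2 x); rewrite mem_cat xB.
  move: xB; rewrite mem_rcons inE => /orP[/eqP->|xB]; first by rewrite index_p.
  by rewrite eq_sym (eqP (allP v4 x xB)).
case: ifP => [/andP[sG szG]|_]; apply: wp_finish => //.
- exact: mem_subseq.
- exact: subseq_uniq sG _.
- by move=> x xB /(noTop x xB).
- by rewrite szG.
- by move=> x xB /(noTop x xB).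
Qed.

End Loss.

(** * Compilation to programs *)

Section Programs.
Variables (R : realType) (n : nat).
Implicit Types (A : program R n) (mem : {set 'I_n}) (M : seq 'I_n).

Fixpoint majority (i j : 'I_n) (s a b : nat) (K : bool -> program R n) :
    program R n :=
  if s is s'.+1 then
    Compare i j (fun ans => majority i j s' (a + ans) (b + ~~ ans) K)
  else K (b < a)%N.

(* A vote that could not legally be held is answered [false]. *)
Fixpoint run (r : nat) M X (t : tree 'I_n X) (K : X -> program R n) :
    program R n :=
  match t with
  | Ret x => K x
  | Vote i j l c =>
      if [&& i != j, i \in M & j \in M] then
        majority i j (l * r) 0 0 (fun b => run r M (c b) K)
      else run r M (c false) K
  end.

Definition discards (l : seq 'I_n) A : program R n := foldr (@Discard R n) A l.

Definition elements (st : state 'I_n) : seq 'I_n := st.1 ++ unzip1 st.2.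

(* Makes legality and the memory bound hold by construction; it is the identity on
   every state that can be reached without failing. *)
Definition restrict (k : nat) M (st : state 'I_n) : state 'I_n :=
  (take (2 * k) [seq x <- st.1 | x \in M],
   take k [seq s <- st.2 | s.1 \in M]).

Fixpoint loop (r k : nat) (ps w : seq 'I_n) (q : nat) (st : state 'I_n) :
    program R n :=
  if w is i :: w' then
    Next (if i \in ps then
      let M := rcons st.1 i ++ unzip1 st.2 in
      Store (run r M (step k (size ps) q st i) (fun st' =>
        let st'' := restrict k M st' in
        discards [seq x <- M | x \notin elements st'']
          (loop r k ps w' q.+1 st'')))
    else loop r k ps w' q st)
  else Output R [set x in unzip1 st.2].

Definition core (r k : nat) (ps : seq 'I_n) : program R n :=
  loop r k ps (enum 'I_n) 0 ([::], [::]).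

(** Draws an index in [0, ..., m], each with probability [1 / (m + 1)], using biased coins only. *)
Fixpoint uniform (m : nat) (A : nat -> program R n) : program R n :=
  if m is m'.+1 then
    Toss (m.+1%:R^-1) (fun b => if b then A m else uniform m' A)
  else A 0%N.

Lemma restrict_sub k M st : {subset elements (restrict k M st) <= M}.
Proof.
move=> x; rewrite /elements mem_cat => /orP[/mem_take|].
  by rewrite mem_filter => /andP[].
by case/mapP => s /mem_take; rewrite mem_filter => /andP[sM _] ->.
Qed.

Lemma restrict_id k M st : {subset elements st <= M} ->
  (size st.1 <= 2 * k)%N -> (size st.2 <= k)%N -> restrict k M st = st.
Proof.
case: st => B S /= sM sB sS; rewrite /restrict /=.
rewrite (_ : [seq x <- B | x \in M] = B).
  rewrite (_ : [seq s <- S | s.1 \in M] = S) ?take_oversize //.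
  apply/all_filterP/allP => s sS'; apply: sM.
  by rewrite /elements mem_cat /= map_f ?orbT.
by apply/all_filterP/allP => x xB; apply: sM; rewrite /elements mem_cat xB.
Qed.

Lemma size_restrict k M st :
  (size (restrict k M st).1 <= 2 * k)%N /\ (size (restrict k M st).2 <= k)%N.
Proof. by rewrite !size_take_min !geq_minl. Qed.

Lemma health_filter_take (I : eqType) m (a : pred (I * nat)) S :
  (health (take m (filter a S)) <= health S)%N.
Proof.
rewrite /health; elim: S m => [|s S IH] m /=; first by case: m.
case: ifP => _; last by apply: leq_trans (IH m) _; rewrite leq_addl.
by case: m => [|m] //=; rewrite leq_add2l.
Qed.

Lemma charge_restrict k N q M st :
  (charge k N q (restrict k M st) <= charge k N q st)%N.
Proof.
rewrite /charge /= leq_add2r; apply: leq_add; last first.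
  by rewrite leq_mul2l health_filter_take.
rewrite leq_add2l leq_mul2l /= size_take_min geq_min.
by rewrite size_filter count_size orbT.
Qed.

(** * Legality, memory and number of comparisons *)

Section Resources.
Variables (r k : nat) (ps : seq 'I_n).

Lemma legal_majority t mem i j s a b K :
  i != j -> i \in mem :|: arriving n t -> j \in mem :|: arriving n t ->
  (forall b, legal_from t mem (K b)) ->
  legal_from t mem (majority i j s a b K).
Proof. by move=> ij im jm lK; elim: s a b => //= s IH a b; split. Qed.

Lemma legal_run t mem M X (u : tree 'I_n X) K :
  {subset M <= mem} -> (forall x, legal_from t mem (K x)) ->
  legal_from t mem (run r M u K).
Proof.
move=> sM lK; elim: u => //= i j l c IH; case: ifP => // /and3P[ij iM jM].
by apply: legal_majority => //; rewrite inE sM.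
Qed.

Lemma legal_discards t mem l A :
  legal_from t (mem :\: [set x in l]) A -> legal_from t mem (discards l A).
Proof.
elim: l mem => /= [|x l IH] mem.
  by rewrite (_ : [set x in [::]] = set0) ?setD0 //; apply/setP => x; rewrite !inE.
move=> h; apply: IH; rewrite setDDl (_ : [set x] :|: _ = [set y in x :: l]) //.
by apply/setP => y; rewrite !inE.
Qed.

Lemma memory_majority t mem i j s a b K C : (#|mem| <= C)%N ->
  (forall b, memory_from t mem (K b) <= C)%N ->
  (memory_from t mem (majority i j s a b K) <= C)%N.
Proof. by move=> mC KC; elim: s a b => //= s IH a b; rewrite !geq_max mC !IH. Qed.

Lemma memory_run t mem M X (u : tree 'I_n X) K C : (#|mem| <= C)%N ->
  (forall x, memory_from t mem (K x) <= C)%N ->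
  (memory_from t mem (run r M u K) <= C)%N.
Proof.
move=> mC KC; elim: u => //= i j l c IH; case: ifP => // _.
exact: memory_majority.
Qed.

Lemma memory_discards t mem l A C : (#|mem| <= C)%N ->
  (memory_from t (mem :\: [set x in l]) A <= C)%N ->
  (memory_from t mem (discards l A) <= C)%N.
Proof.
elim: l mem => /= [|x l IH] mem mC.
  by rewrite (_ : [set x in [::]] = set0) ?setD0 //; apply/setP => x; rewrite !inE.
move=> h; rewrite geq_max mC; apply: IH.
  by apply: leq_trans mC; rewrite subset_leq_card ?subD1set.
rewrite setDDl (_ : [set x] :|: _ = [set y in x :: l]) //.
by apply/setP => y; rewrite !inE.
Qed.

Lemma stored_set (st : state 'I_n) (i : 'I_n) :
  [set x in elements st] :|: arriving n i.+1 =
  [set x in rcons st.1 i ++ unzip1 st.2].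
Proof.
apply/setP => x; rewrite !inE cat_rcons /elements !mem_cat inE eqSS val_eqE.
by rewrite orbCA -!orbA; do !bool_congr.
Qed.

Lemma kept_set M (st : state 'I_n) : {subset elements st <= M} ->
  [set x in M] :\: [set x in [seq x <- M | x \notin elements st]] =
  [set x in elements st].
Proof.
move=> sM; apply/setP => x; rewrite !inE mem_filter negb_and negbK.
by case: (boolP (x \in elements st)) => [/sM ->|] //=; case: (x \in M).
Qed.

Lemma drop_enum t i w : i :: w = drop t (enum 'I_n) ->
  val i = t /\ w = drop t.+1 (enum 'I_n).
Proof.
move=> di; have tn : (t < n)%N.
  by rewrite -[n]size_enum_ord ltnNge -subn_eq0 -size_drop -di.
move: di; rewrite (drop_nth i) ?size_enum_ord // => -[e ->]; split=> //.
by rewrite e [LHS]nth_enum_ord.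
Qed.

Lemma legal_loop t w q st : w = drop t (enum 'I_n) ->
  legal_from t [set x in elements st] (loop r k ps w q st).
Proof.
elim: w t q st => [|i w IH] t q st /=.
  by move=> _; apply/subsetP => x; rewrite !inE mem_cat orbC => ->.
case/drop_enum => <- ew; split; first exact: ltn_ord.
case: ifP => _; last exact: IH.
rewrite /= stored_set; apply: legal_run => [x|st']; first by rewrite inE.
apply: legal_discards; rewrite kept_set; first exact: IH.
exact: restrict_sub.
Qed.

Lemma card_elements (st : state 'I_n) :
  (size st.1 <= 2 * k)%N -> (size st.2 <= k)%N ->
  (#|[set x in elements st]| <= 4 * k)%N.
Proof.
move=> sB sS; rewrite cardsE (leq_trans (card_size _)) // size_cat size_map.
by apply: leq_trans (leq_add sB sS) _; rewrite -mulSnr leq_mul2r orbT.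
Qed.

(** Buffer, slots and arriving element take at most [2 * k + k + 1] places. *)
Lemma memory_loop t w q st : (0 < k)%N -> w = drop t (enum 'I_n) ->
  (size st.1 <= 2 * k)%N -> (size st.2 <= k)%N ->
  (memory_from t [set x in elements st] (loop r k ps w q st) <= 4 * k)%N.
Proof.
move=> k0; elim: w t q st => [|i w IH] t q st /=.
  move=> _ sB sS; rewrite geq_max andbT; exact: card_elements.
case/drop_enum => it ew sB sS; rewrite geq_max card_elements //=; case: ifP => _; last first.
  by rewrite -it; apply: IH; rewrite ?it.
have cM : (#|[set x in rcons st.1 i ++ unzip1 st.2]| <= 4 * k)%N.
  rewrite cardsE (leq_trans (card_size _)) // size_cat size_rcons size_map.
  by rewrite addSn (leq_ltn_trans (leq_add sB sS)) // -mulSnr ltn_pmul2r.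
rewrite geq_max card_elements // -it stored_set.
apply: memory_run => // st'.
have [sB' sS'] := size_restrict k (rcons st.1 i ++ unzip1 st.2) st'.
apply: memory_discards => //; rewrite kept_set; last exact: restrict_sub.
by apply: IH; rewrite ?it.
Qed.

Lemma comparisons_majority i j s a b K C :
  (forall b, comparisons (K b) <= C)%N ->
  (comparisons (majority i j s a b K) <= s + C)%N.
Proof. by move=> KC; elim: s a b => //= s IH a b; rewrite addSn ltnS geq_max !IH. Qed.

Lemma comparisons_run M X (u : tree 'I_n X) K (f : X -> nat) :
  (forall x, comparisons (K x) <= r * f x)%N ->
  (comparisons (run r M u K) <= r * mcost f u)%N.
Proof.
move=> Kf; elim: u => //= i j l c IH; rewrite mulnDr; case: ifP => _; last first.
  apply: leq_trans (IH false) _; rewrite (leq_trans _ (leq_addl _ _)) //.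
  by rewrite leq_mul2l leq_maxr orbT.
rewrite mulnC; apply: comparisons_majority => b; apply: leq_trans (IH b) _.
by rewrite leq_mul2l; case: b; rewrite ?leq_maxl ?leq_maxr orbT.
Qed.

Lemma comparisons_discards l A : comparisons (discards l A) = comparisons A.
Proof. by elim: l. Qed.

Lemma drop_ps w i q : drop q ps = [seq x <- i :: w | x \in ps] -> i \in ps ->
  [/\ (q < size ps)%N, i = nth i ps q & drop q.+1 ps = [seq x <- w | x \in ps]].
Proof.
move=> /= + ips; rewrite ips => dq.
have qN : (q < size ps)%N by rewrite ltnNge -subn_eq0 -size_drop dq.
by move: dq; rewrite (drop_nth i) // => -[e1 e2]; rewrite e1 -e2.
Qed.

Lemma comparisons_loop w q st : (0 < k)%N ->
  drop q ps = [seq x <- w | x \in ps] ->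
  (comparisons (loop r k ps w q st) <= r * charge k (size ps) q st)%N.
Proof.
move=> k0; elim: w q st => [|i w IH] q st //= dq.
case: (boolP (i \in ps)) dq => ips dq; last exact: IH.
have [|qN def_i dq'] := @drop_ps w i q _ ips; first by rewrite /= ips.
set M := rcons st.1 i ++ unzip1 st.2.
apply: leq_trans (comparisons_run M _ (f := fun st' =>
  charge k (size ps) q.+1 (restrict k M st')) _) _.
  by move=> st'; rewrite comparisons_discards; exact: IH.
by rewrite leq_mul2l mcost_step ?orbT // => st'; exact: charge_restrict.
Qed.

Lemma comparisons_loop_small w q st : (0 < k)%N -> (0 < r)%N -> (size ps <= k)%N ->
  drop q ps = [seq x <- w | x \in ps] ->
  (size st.1 <= q)%N -> ((q < size ps)%N -> st.2 = [::]) ->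
  comparisons (loop r k ps w q st) = 0%N.
Proof.
move=> k0 r0 Nk; elim: w q st => [|i w IH] q st //= dq sB sS.
case: (boolP (i \in ps)) dq => ips dq; last exact: IH.
have [|qN def_i dq'] := @drop_ps w i q _ ips; first by rewrite /= ips.
apply/eqP; rewrite -leqn0.
(* The leaf cost is taken to be the cost of the continuation itself, which vanishes by induction. *)
apply: leq_trans (comparisons_run _ _ (f := fun st' => comparisons
  (loop r k ps w q.+1 (restrict k (rcons st.1 i ++ unzip1 st.2) st'))) _) _.
  by move=> st'; rewrite comparisons_discards leq_pmull.
rewrite leqn0 muln_eq0; apply/orP; right; apply/eqP.
case: st sB sS => B S /= sB /(_ qN) S0; rewrite {}S0.
apply: mcost_small => // st' sB' sS'; apply: IH => //.
  rewrite size_take_min geq_min; apply/orP; right; apply: leq_trans sB'.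
  by rewrite size_filter count_size.
by move=> /sS' /= ->.
Qed.

End Resources.
End Programs.

(** * Success probability *)

Section Probability.
Variables (R : realType) (n : nat) (gamma : R) (d : Order.disp_t) (T : orderType d).
Variables (s : n.-tuple T) (adv : adversary n) (out : {set 'I_n}).
Hypotheses (g0 : 0 < gamma) (g2 : gamma <= 1 / 2).

Local Notation P := (output_prob_from gamma s adv out).

Lemma output_prob_ge0 t mem (A : program R n) h : legal_from t mem A -> 0 <= P h A.
Proof.
have [p1 p2] : 0 <= 1 / 2 + gamma /\ 0 <= 1 / 2 - gamma.
  by have := g0; have := g2; split; lra.
elim: A t mem h => /= [o|p c IH|i j c IH|A IH|A IH|i A IH] t mem h.
- by move=> _; exact: ler0n.
- case=> /andP[q0 q1] l; rewrite addr_ge0 // mulr_ge0 ?subr_ge0 //; exact: IH.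
- by case=> _ _ _ l; rewrite addr_ge0 // mulr_ge0 //; exact: IH.
- by case=> _; exact: IH.
- exact: IH.
- exact: IH.
Qed.

(** After multiplication by [1 - gamma] the two sides differ by [gamma ^+ 2 / 2]. *)
Lemma weight_step : (1 / 2 + gamma) * (1 - gamma) + (1 / 2 - gamma) / (1 - gamma)
  <= 1 - gamma ^+ 2.
Proof.
have := g0; have := g2; move: (gamma) => g h2 h0.
have v0 : 0 < 1 - g by lra.
rewrite -(ler_pM2r v0) mulrDl mulfVK ?gt_eqF // !expr2.
have : 0 <= g * g by rewrite mulr_ge0 ?ltW.
have : 0 <= g * (g * g) by rewrite !mulr_ge0 ?ltW.
nra.
Qed.

(* Exponential moments: weighting true answers by [1 - gamma] and false ones by
   its inverse, each comparison shrinks the weight by [1 - gamma ^+ 2] on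
   average, whatever the adversary does. *)
Lemma majority_ge i j truth m a b (K : bool -> program R n) h (A D : R) :
  (tnth s i < tnth s j)%O = truth -> 0 <= D ->
  (forall h, A <= P h (K truth)) -> (forall h, A - D <= P h (K (~~ truth))) ->
  A - D * ((1 - gamma ^+ 2) ^+ m * ((1 - gamma) ^+ (if truth then a else b) /
                                    (1 - gamma) ^+ (if truth then b else a)))
    <= P h (majority i j m a b K).
Proof.
move=> ht D0 Kt Kf; have := weight_step; have [h0 h2] := (g0, g2).
have v0 : 0 < 1 - gamma by lra.
have rho0 : 0 <= 1 - gamma ^+ 2.
  have : gamma ^+ 2 <= 1 ^+ 2 by rewrite lerXn2r ?nnegrE //; lra.
  by rewrite expr1n; lra.
have v1 : 1 - gamma <= 1 by lra.
move: (1 - gamma) (1 - gamma ^+ 2) v0 v1 rho0 => v rho v0 v1 rho0 ws.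
elim: m a b h => [|m IH] a b h /=.
  rewrite expr0 mul1r.
  have w0 x y : 0 <= v ^+ x / v ^+ y by rewrite divr_ge0 ?exprn_ge0 ?(ltW v0).
  case: (eqVneq (b < a)%N truth) => [->|ne].
    by apply: le_trans (Kt h); rewrite gerBl mulr_ge0.
  (* The vote is wrong, ties counting as [false]; the weight is then at least 1 and covers the whole
     loss [D]. *)
  have -> : (b < a)%N = ~~ truth by move: ne; case: (truth); case: (b < a)%N.
  apply: le_trans (Kf h); rewrite lerD2l lerN2 ler_peMr //.
  rewrite ler_pdivlMr ?exprn_gt0 // mul1r ler_wiXn2l ?(ltW v0) //.
  by move: ne; case: (truth); case: (ltnP b a) => // ba _; rewrite ?ba ?(ltnW ba).
set w := v ^+ _ / v ^+ _.
have w0 : 0 <= w by rewrite divr_ge0 ?exprn_ge0 ?(ltW v0).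
set X := D * (rho ^+ m * w).
have X0 : 0 <= X by apply: mulr_ge0 => //; apply: mulr_ge0 => //; apply: exprn_ge0.
have wS x y : v ^+ x.+1 / v ^+ y = v ^+ x / v ^+ y * v.
  by rewrite exprS -mulrA mulrC.
have wV x y : v ^+ x / v ^+ y.+1 = v ^+ x / v ^+ y / v.
  by rewrite exprSr invfM mulrA.
have good h' : A - X * v <= P h' (majority i j m (a + truth) (b + ~~ truth) K).
  apply: le_trans (IH _ _ _); rewrite (_ : X * v = D * (rho ^+ m * (w * v))).
    by rewrite /w; case: (truth); rewrite ?addn0 addn1 wS.
  by rewrite /X -!mulrA.
have bad h' : A - X / v <= P h' (majority i j m (a + ~~ truth) (b + truth) K).
  apply: le_trans (IH _ _ _); rewrite (_ : X / v = D * (rho ^+ m * (w / v))).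
    by rewrite /w; case: (truth); rewrite ?addn0 addn1 wV.
  by rewrite /X -!mulrA.
(* The adversary may also answer truthfully, which only helps, since [v <= v^-1]. *)
have any h' (c : bool) : A - X / v <= P h' (majority i j m (a + c) (b + ~~ c) K).
  have vv : v <= v^-1 by apply: (le_trans v1); rewrite invf_ge1.
  case: (eqVneq c truth) => [->|ne].
    by apply: le_trans (good h'); rewrite lerD2l lerN2 ler_wpM2l.
  have -> : c = ~~ truth by move: ne; case: (c); case: (truth).
  by rewrite negbK; exact: bad.
rewrite ht; have q1 : 0 <= 1 / 2 + gamma by lra.
have q2 : 0 <= 1 / 2 - gamma by lra.
apply: le_trans (lerD (ler_wpM2l q1 (good _)) (ler_wpM2l q2 (any _ _))).
have -> : D * (rho ^+ m.+1 * w) = X * rho by rewrite /X exprS; ring.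
have := ler_wpM2l X0 ws.
move: (v^-1) => iv; lra.
Qed.

(** The oracle [o] is false outside the memory [M], like the default answer of [run]; inside it,
    [l * r] comparisons err with probability at most [e ^+ l]. *)
Lemma run_ge r M X (t : tree 'I_n X) (K : X -> program R n) (f : X -> R) h :
  let e := (1 - gamma ^+ 2) ^+ r in
  let o i j := [&& i \in M, j \in M & (tnth s i < tnth s j)%O] in
  (forall x, 0 <= f x) -> (forall x h, 1 - f x <= P h (K x)) ->
  1 - wp e o f t <= P h (run r M t K).
Proof.
move=> e o f0 Kf; have [h0 h2] := (g0, g2).
have e0 : 0 <= e.
  rewrite exprn_ge0 //.
  have : gamma ^+ 2 <= 1 ^+ 2 by rewrite lerXn2r ?nnegrE //; lra.
  by rewrite expr1n; lra.
elim: t h => [x|i j l c IH] h /=; first exact: Kf.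
case: ifP => g; last first.
  have -> : o i j = false.
    rewrite /o; case: eqVneq g => [->|_] /=; first by rewrite ltxx !andbF.
    by case: (i \in M) => //= ->.
  apply: le_trans (IH false h); rewrite lerD2l lerN2 lerDl; apply: mulr_ge0.
    exact: exprn_ge0.
  by rewrite le_max lexx.
set wt := wp e o f (c (o i j)); set wl := wp e o f _.
have oE : o i j = (tnth s i < tnth s j)%O by case/and3P: g => _ iM jM; rewrite /o iM jM.
have := @majority_ge i j (o i j) (l * r) 0 0 (fun b => run r M (c b) K) h
  (1 - wt) (Num.max 0 (wl - wt)) (esym oE).
rewrite /= !if_same expr0 divr1 mulr1 mulnC exprM -/e opprD addrA [_ * e ^+ l]mulrC.
apply.
- by rewrite le_max lexx.
- by move=> h'; exact: IH.
- move=> h'; apply: le_trans (IH _ _); rewrite -/wl.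
  have : wl - wt <= Num.max 0 (wl - wt) by rewrite le_max lexx orbT.
  lra.
Qed.

Lemma discards_prob l h (A : program R n) : P h (discards l A) = P h A.
Proof. by elim: l. Qed.

Lemma uniform_ge m (A : nat -> program R n) j a h : (j <= m)%N ->
  (forall i h, 0 <= P h (A i)) -> (forall h, a <= P h (A j)) ->
  a / m.+1%:R <= P h (uniform m A).
Proof.
move=> + A0 Aj; elim: m h => [|m IH] h /=.
  by rewrite leqn0 divr1 => /eqP j0; have := Aj h; rewrite j0.
have U0 h' m' : 0 <= P h' (uniform m' A).
  elim: m' h' => [|m' IH'] h' //=.
  rewrite addr_ge0 // mulr_ge0 ?invr_ge0 ?subr_ge0 //.
  by rewrite invf_le1 ?ltr0n // ler1n.
have m0 : 0 < m.+1%:R :> R by rewrite ltr0n.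
have m1 : 0 < m.+2%:R :> R by rewrite ltr0n.
have q : 1 - m.+2%:R^-1 = m.+1%:R / m.+2%:R :> R.
  apply: (mulIf (lt0r_neq0 m1)).
  by rewrite mulrBl mulVf ?mulfVK ?lt0r_neq0 // mul1r -[m.+2]addn1 natrD addrK.
have i0 : 0 <= m.+2%:R^-1 :> R by rewrite invr_ge0.
have i1 : 0 <= m.+1%:R / m.+2%:R :> R by rewrite mulr_ge0.
rewrite q leq_eqVlt => /orP[/eqP jm|jm].
  rewrite jm in Aj; rewrite mulrC -[leLHS]addr0; apply: lerD.
    by rewrite ler_wpM2l.
  by apply: mulr_ge0.
rewrite -[leLHS]add0r; apply: lerD; first exact: mulr_ge0.
apply: le_trans (ler_wpM2l _ (IH _ jm)); last exact: i1.
by rewrite [leRHS]mulrC mulrA mulfVK ?lt0r_neq0.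
Qed.

End Probability.

(** * Ranks within a list of positions and the set of the k largest *)

Section Rank.
Variables (d : Order.disp_t) (T : orderType d) (n : nat) (s : n.-tuple T).
Hypothesis us : uniq s.

Definition rank (ps : seq 'I_n) (i : 'I_n) : nat :=
  count (fun j => (tnth s i < tnth s j)%O) ps.

Variable ps : seq 'I_n.
Hypothesis ups : uniq ps.

Lemma rank_lt : {in ps &, forall x y,
  (rank ps y < rank ps x)%N = (tnth s x < tnth s y)%O}.
Proof.
have main x y : y \in ps -> (tnth s x < tnth s y)%O -> (rank ps y < rank ps x)%N.
  move=> yp xy; rewrite /rank -(count_predU1 ups yp) ?ltxx //.
  by apply: sub_count => z /= /orP[/eqP -> //|]; exact: lt_trans.
move=> x y xp yp; apply/idP/idP; last exact: main.
case: (ltgtP (tnth s x) (tnth s y)) => // [yx|/(tuple_uniqP _ us) ->].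
  by have := main _ _ xp yx; case: ltngtP.
by rewrite ltnn.
Qed.

Lemma rank_inj : {in ps &, injective (rank ps)}.
Proof.
move=> x y xp yp xy; apply: (tuple_uniqP _ us).
have := rank_lt xp yp; have := rank_lt yp xp; rewrite xy ltnn.
by case: ltgtP.
Qed.

Lemma size_topmost_rank k : (k <= size ps)%N -> size (topmost k ps (rank ps)) = k.
Proof.
move=> kp; pose rs := map (rank ps) ps.
have urs : uniq rs by rewrite map_inj_in_uniq //; exact: rank_inj.
have sub : {subset rs <= iota 0 (size ps)}.
  move=> _ /mapP[x xp ->]; rewrite mem_iota /= add0n /rank.
  rewrite -(count_predC (fun j => (tnth s x < tnth s j)%O)).
  rewrite -[X in (X < _)%N]addn0 ltn_add2l -has_count.
  by apply/hasP; exists x => //=; rewrite ltxx.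
have le : (size (iota 0 (size ps)) <= size rs)%N by rewrite size_map size_iota.
have [_ eqs] := uniq_min_size urs sub le.
have /permP pe : perm_eq rs (iota 0 (size ps)) by apply: uniq_perm; rewrite ?iota_uniq.
rewrite size_filter -(count_map (rank ps) (fun r => (r < k)%N)) pe -size_filter.
by have := filter_iota_ltn 0 kp; rewrite add0n => ->; rewrite size_iota.
Qed.

End Rank.

Section Largest.
Variables (d : Order.disp_t) (T : orderType d) (n : nat) (s : n.-tuple T).
Hypothesis us : uniq s.

Lemma rank_enum i : rank s (enum 'I_n) i = #|[set j | (tnth s i < tnth s j)%O]|.
Proof.
rewrite cardE /rank -size_filter.
apply/perm_size/uniq_perm; [exact/filter_uniq/enum_uniq|exact: enum_uniq|] => x.
by rewrite mem_filter !mem_enum !inE andbT.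
Qed.

Lemma card_largest k : (k <= n)%N -> #|largest s k| = k.
Proof.
move=> kn; rewrite -[RHS](@size_topmost_rank _ _ _ s us _ (enum_uniq 'I_n));
  last by rewrite size_enum_ord.
rewrite cardE; apply/perm_size/uniq_perm => [||x].
- exact: enum_uniq.
- exact/filter_uniq/enum_uniq.
- by rewrite mem_enum /topmost [RHS]mem_filter mem_enum !inE andbT rank_enum.
Qed.

(** One of the [k] largest has fewer than [k] larger elements in [ps] as well; this gives one
    inclusion, and both sets have [k] elements. *)
Lemma topmost_largest k ps : uniq ps -> (k <= size ps)%N -> (k <= n)%N ->
  {subset largest s k <= ps} ->
  [set x in topmost k ps (rank s ps)] = largest s k.
Proof.
move=> ups kp kn sub; apply/eqP; rewrite eq_sym eqEcard card_largest //; apply/andP; split.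
  apply/subsetP => x xl; rewrite inE mem_filter sub // andbT.
  move: xl; rewrite inE; apply: leq_ltn_trans.
  rewrite /rank -size_filter cardE; apply: uniq_leq_size; first exact: filter_uniq.
  by move=> y; rewrite mem_filter mem_enum inE => /andP[].
by rewrite cardsE (leq_trans (card_size _)) // size_topmost_rank.
Qed.

End Largest.

(** * Success probability of one pass *)

Section Core.
Variables (R : realType) (n : nat) (gamma : R) (d : Order.disp_t) (T : orderType d).
Variables (s : n.-tuple T) (adv : adversary n).
Hypotheses (g0 : 0 < gamma) (g2 : gamma <= 1 / 2) (us : uniq s).
Variables (r k : nat) (ps : seq 'I_n) (th : R).
Hypotheses (k0 : (0 < k)%N) (ups : uniq ps) (kp : (k <= size ps)%N).

Let e := (1 - gamma ^+ 2) ^+ r.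
Let rk := rank s ps.
Let out := [set x in topmost k ps rk].

Hypotheses (th0 : 0 < th) (th2 : th <= 1 / 2) (eth : e <= th ^+ 2 / 2).

Local Notation P := (output_prob_from gamma s adv out).

Let e0 : 0 <= e.
Proof.
have [h0 h2] := (g0, g2); rewrite exprn_ge0 //.
have : gamma ^+ 2 <= 1 ^+ 2 by rewrite lerXn2r ?nnegrE //; lra.
by rewrite expr1n; lra.
Qed.

Let bounded (p : R) (q : nat) (st : state 'I_n) :
  1 - bound k ps rk e th q st <= p -> 0 <= p -> 1 - loss k ps rk e th q st <= p.
Proof.
rewrite /loss => h p0; case: ifP => _; last by rewrite subrr.
by rewrite /Num.min; case: ifP => _ //; rewrite subrr.
Qed.

(** Induction over the remaining arrivals with [loss] as potential. At the end of a valid run the at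
    most [k] slots contain the [k] topmost elements, hence nothing else. *)
Lemma loop_ge w t q st h : w = drop t (enum 'I_n) ->
  drop q ps = [seq x <- w | x \in ps] -> (q <= size ps)%N ->
  1 - loss k ps rk e th q st <= P h (loop R r k ps w q st).
Proof.
elim: w t q st h => [|i w IH] t q st h /= ew dq qN.
  have {}qN : q = size ps.
    apply/eqP; rewrite eqn_leq qN /= -subn_eq0 -size_drop.
    by rewrite (_ : drop q ps = [::]).
  case: (boolP (valid k ps rk q st)) => v; last by rewrite /loss (negbTE v) subrr.
  rewrite (_ : (_ == out)) ?gerBl ?loss_ge0 //.
  move: v; rewrite /valid qN take_size eqxx ltnn => /and5P[u1 u2 u3 u4 /and4P[u5 u6 u7 _]].
  case: st u1 u2 u3 u4 u5 u6 u7 => B S /= + + + _ _ + /nilP B0; rewrite {}B0 /=.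
  move=> uS aS tS sS; apply/eqP/setP => x; rewrite !inE.
  have sz : (size (unzip1 S) <= size (topmost k ps rk))%N.
    by rewrite size_map size_topmost_rank.
  have sub : {subset topmost k ps rk <= unzip1 S}.
    by move=> y; rewrite mem_filter => /andP[yk yp]; exact: (implyP (allP tS y yp)).
  by have [_ ->] := uniq_min_size (filter_uniq _ ups) sub sz.
have p0 := output_prob_ge0 s adv out g0 g2 h (legal_loop R r k ps q st ew).
rewrite /= in p0; have [_ ew'] := drop_enum ew.
case: (boolP (i \in ps)) dq p0 => ips dq p0; last exact: (IH t.+1).
have [|qN' def_i dq'] := drop_ps (w := w) (q := q) _ ips; first by rewrite /= ips.
set M := rcons st.1 i ++ unzip1 st.2.
pose o x y := [&& x \in M, y \in M & (tnth s x < tnth s y)%O].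
pose f st' := loss k ps rk e th q.+1 (restrict k M st').
case: (boolP (valid k ps rk q st)) => v; last first.
  by rewrite {1}/loss (negbTE v) subrr.
apply: bounded => // {p0}.
have f0 st' : 0 <= f st' by exact: loss_ge0.
apply: le_trans (run_ge g0 g2 _ _ _ _ f0 _); last first.
  by move=> st' h'; rewrite discards_prob; exact: (IH t.+1).
rewrite lerD2l lerN2; case: st v @M @o @f f0 => B S v M o f f0.
have [v1 v2 _] := and3P v.
have Mps : {subset M <= ps}.
  move=> x; rewrite /M cat_rcons mem_cat inE orbCA => /orP[/eqP -> //|xq].
  by apply: (mem_take (n0 := q)); apply: (allP v2); rewrite mem_cat.
apply: wp_step => //.
- split=> [x y xM yM|x y xM yM]; last by apply: rank_inj => //; exact: Mps.
  by rewrite /o xM yM /gt rank_lt ?Mps.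
- by move=> st'; apply: loss_le1.
- move=> st' v' sub; rewrite /f restrict_id //; first exact: loss_le_bound.
    by case/and5P: v' => _ _ _ _ /andP[/ltnW].
  by case/and5P: v' => _ _ _ _ /and3P[].
Qed.

(** Initially there are [k] empty slots of risk [kappa], and at most [k ^ 3] critical steps of risk
    [242 * k * e] lie ahead. *)
Lemma core_ge h : filter (mem ps) (enum 'I_n) = ps ->
  1 - (k%:R * (2 * e + th) + (242 * k ^ 4)%:R * e) <= P h (core R r k ps).
Proof.
move=> eps; apply: le_trans (loop_ge (t := 0) _ _ _ _ _) => //.
- rewrite lerD2l lerN2; apply: le_trans (loss_le_bound _ _ _) _.
    by rewrite /valid /= take0 /= muln_gt0 k0 /= implybT /=; case: ifP; rewrite ?implybT.
  rewrite /bound risk_nil lerD2l /prune_risk mulrAC ler_wpM2r // -natrM ler_nat.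
  rewrite -mulnA leq_mul2l (expnS k 3) leq_mul2l leq_criticals ?orbT //.
  exact: rank_inj.
- by rewrite drop0.
- by rewrite drop0; exact: (esym eps).
Qed.

End Core.

(** * Choice of the constants *)

Section UniformResources.
Variables (R : realType) (n : nat).
Implicit Type A : nat -> program R n.

Lemma legal_uniform t mem m A : (forall j, legal_from t mem (A j)) ->
  legal_from t mem (uniform m A).
Proof.
move=> lA; elim: m => [|m IH] /=; first exact: lA.
split=> [|[]]; [|exact: lA|exact: IH].
by rewrite invr_ge0 ler0n invf_le1 ?ltr0n // ler1n.
Qed.

Lemma memory_uniform t mem m A C : (forall j, (memory_from t mem (A j) <= C)%N) ->
  (memory_from t mem (uniform m A) <= C)%N.
Proof.
move=> cA; have mC : (#|mem| <= C)%N.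
  by apply: leq_trans (cA 0%N); case: (A 0%N) => *; rewrite /= leq_maxl.
by elim: m => [|m IH] //=; rewrite !geq_max mC cA IH.
Qed.

Lemma comparisons_uniform m A :
  exists j, (comparisons (uniform m A) <= comparisons (A j))%N.
Proof.
elim: m => [|m [j IH]] /=; first by exists 0%N.
case: (leqP (comparisons (A m.+1)) (comparisons (uniform m A))) => [_|_].
  by exists j.
by exists m.+1.
Qed.

(** The initial charge is 249 per element, plus [3 * k ^ 2] when the cascade is used; in that case
    [k ^ 2] is below the number of elements, whence 252. *)
Lemma comparisons_core r k (ps : seq 'I_n) : (0 < k)%N -> (0 < r)%N ->
  filter (mem ps) (enum 'I_n) = ps ->
  (comparisons (core R r k ps) <= 252 * r * ((k < size ps)%N * size ps))%N.
Proof.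
move=> k0 r0 eps; case: ltnP => kp; last first.
  rewrite muln0 leqn0; apply/eqP; apply: comparisons_loop_small => //.
  by rewrite drop0; exact: esym eps.
apply: leq_trans (comparisons_loop _ _ _ _ _) _ => //.
  by rewrite drop0; exact: esym eps.
rewrite mul1n [(252 * r)%N]mulnC -mulnA leq_mul2l; apply/orP; right.
rewrite /charge /health /direct mod0n /= muln0 !addn0 subn0; move: (k ^ 2)%N => L.
by case: (leqP (size ps) L); case: (size ps) => [|N] /=; clear; lia.
Qed.

End UniformResources.

Section Constants.
Variable R : realType.
Implicit Types x y gamma delta e : R.

Lemma ln_ge y : 0 < y -> 1 - y^-1 <= ln y.
Proof.
move=> y0; have yi : 0 < y^-1 by rewrite invr_gt0.
rewrite -[y in ln y]invrK lnV ?posrE //.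
have := @le_ln1Dx R (y^-1 - 1); rewrite addrCA subrr addr0 => h.
by have := h (ltac:(lra)); lra.
Qed.

Definition rounds gamma y : nat := (Num.truncn (14 * ln y / gamma ^+ 2)).+1.

Lemma rounds_spec gamma y : 0 < gamma -> gamma <= 1 / 2 -> 2 <= y ->
  [/\ (1 - gamma ^+ 2) ^+ rounds gamma y <= (y^-1) ^+ 14,
      (rounds gamma y)%:R <= 16 * (ln y / gamma ^+ 2) & 1 / 2 <= ln y].
Proof.
move=> g0 g2 y2; have y0 : 0 < y by lra.
have l2 : 1 / 2 <= ln y.
  apply: le_trans (ln_ge y0).
  have : y^-1 <= 2^-1 by rewrite lef_pV2 ?posrE.
  lra.
have gg0 : 0 < gamma ^+ 2 by rewrite exprn_gt0.
have gg1 : gamma ^+ 2 <= 1.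
  by rewrite -[leRHS](expr1n R 2) lerXn2r ?nnegrE //; lra.
have q0 : 0 <= 14 * ln y / gamma ^+ 2 by rewrite divr_ge0 ?(ltW gg0) // mulr_ge0 //; lra.
have /andP[t1 t2] := truncn_itv q0.
split=> //; last first.
  (* Since [ln y >= 1 / 2] and [gamma ^+ 2 <= 1], rounding up costs at most two more units of
     [ln y / gamma ^+ 2], whence 16 instead of 14. *)
  rewrite /rounds -natr1; have : 1 <= 2 * (ln y / gamma ^+ 2).
    rewrite mulrA ler_pdivlMr // mul1r; lra.
  by move: t1; rewrite -mulrA; lra.
apply: le_trans (_ : expR (- gamma ^+ 2) ^+ rounds gamma y <= _).
  by rewrite lerXn2r ?nnegrE ?expR_ge0 ?expR_ge1Dx //; lra.
rewrite -expRM_natr -[y in leRHS](@lnK R) ?posrE // -expRN -expRM_natr ler_expR.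
by rewrite !mulNr lerN2 [leRHS]mulrC -ler_pdivrMr // [ln y * _]mulrC ltW.
Qed.

(** Of the exponent 14, four factors cancel [k ^ 4] and ten give [1 / 1024], as
    [delta / k <= 1 / 2]; this absorbs the 242. The choice of [th] makes [k * th] equal to
    [delta / 4]. *)
Lemma risk_small delta e (k : nat) : (0 < k)%N -> 0 < delta -> delta <= 1 / 2 ->
  0 <= e -> e <= (delta / k%:R) ^+ 14 ->
  let th := delta / k%:R / 4 in
  [/\ 0 < th, th <= 1 / 2, e <= th ^+ 2 / 2
    & k%:R * (2 * e + th) + (242 * k ^ 4)%:R * e <= delta].
Proof.
move=> k0 d0 d2 e0 ex; set x := delta / k%:R in ex *.
have kR : 1 <= k%:R :> R by rewrite ler1n.
have kx : k%:R * x = delta by rewrite mulrC mulfVK // gt_eqF // ltr0n.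
have x0 : 0 < x by rewrite divr_gt0 ?ltr0n.
have x2 : x <= 1 / 2.
  by apply: le_trans d2; rewrite ler_pdivrMr ?ltr0n // ler_peMr // ltW.
have e4 : e <= x ^+ 4 / 1024.
  apply: le_trans ex _; rewrite -[14%N]/(4 + 10)%N exprD ler_wpM2l ?exprn_ge0 ?(ltW x0) //.
  apply: le_trans (_ : (1 / 2) ^+ 10 <= _).
    by rewrite lerXn2r ?nnegrE ?(ltW x0) //; lra.
  by rewrite expr_div_n expr1n div1r -natrX.
have x42 : x ^+ 4 <= x ^+ 2 by rewrite ler_wiXn2l ?(ltW x0) //; lra.
have x20 : 0 <= x ^+ 2 by rewrite exprn_ge0 ?(ltW x0).
have ke : k%:R ^+ 4 * e <= delta / 1024.
  apply: le_trans (_ : k%:R ^+ 4 * (x ^+ 4 / 1024) <= _).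
    by rewrite ler_wpM2l // exprn_ge0 // ler0n.
  rewrite mulrA -exprMn kx ler_wpM2r ?invr_ge0 // exprS ler_piMr ?(ltW d0) //.
  by rewrite exprn_ile1 ?(ltW d0) //; lra.
have ke1 : k%:R * e <= k%:R ^+ 4 * e by rewrite ler_wpM2r // ler_eXnr.
split=> /=.
- by lra.
- by lra.
- by rewrite expr_div_n; lra.
- have -> : k%:R * (2 * e + x / 4) = 2 * (k%:R * e) + k%:R * x / 4 by field.
  rewrite kx natrM natrX -mulrA; lra.
Qed.

End Constants.

(** * Sampling a residue class of positions *)

Definition residue (n m j : nat) : seq 'I_n :=
  [seq i : 'I_n <- enum 'I_n | (i %% m == j)%N].

Lemma residue_enum n m j : filter (mem (residue n m j)) (enum 'I_n) = residue n m j.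
Proof.
by apply: eq_filter => i; rewrite /= mem_filter mem_enum andbT.
Qed.

Lemma size_residue n m j : (0 < m)%N -> ((size (residue n m j)).-1 * m <= n)%N.
Proof.
move=> m0; pose ds := [seq (val i %/ m)%N | i <- residue n m j].
have : (size ds <= size (iota 0 (n %/ m).+1))%N.
  apply: uniq_leq_size.
    rewrite map_inj_in_uniq => [|x y]; first exact/filter_uniq/enum_uniq.
    rewrite !mem_filter => /andP[/eqP xj _] /andP[/eqP yj _] xy; apply: val_inj.
    by rewrite /= (divn_eq x m) (divn_eq y m) xj yj xy.
  move=> _ /mapP[i _ ->]; rewrite mem_iota /= ltnS leq_div2r // ltnW //.
rewrite size_map size_iota => h; apply: leq_trans (leq_divM n m).
by rewrite leq_mul2r -subn1 leq_subLR add1n h orbT.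
Qed.

(* For [k = 1] and [delta] close to 1 the budget [ln (1 / delta)] is below one
   comparison per element: the maximum is then sought in a random residue class
   of positions only. *)
Definition spread (R : realType) (k : nat) (delta : R) : nat :=
  if (k == 1)%N && (1 / 2 < delta) then Num.truncn (1 / (2 * (1 - delta)))
  else 1.

(** Capping [delta] at 1/2 keeps [k / delta'] at least 2, hence its logarithm bounded away from
    0. *)
Definition top_program (R : realType) (n k : nat) (gamma delta : R) : program R n :=
  let delta' := Num.min delta (1 / 2) in
  uniform (spread k delta).-1 (fun j =>
    core R (rounds gamma (k%:R / delta')) k (residue n (spread k delta) j)).

(** * Guarantees of the algorithm *)

Section Top.
Variables (R : realType) (n k : nat) (gamma delta : R).
Hypotheses (kn : (1 <= k <= n)%N) (hg : 0 < gamma <= 1 / 2) (hd : 0 < delta < 1).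

Let delta' := Num.min delta (1 / 2).
Let y := k%:R / delta'.

Let k0 : (0 < k)%N. Proof. by case/andP: kn. Qed.

Let delta'_bounds : 0 < delta' /\ delta' <= 1 / 2.
Proof.
case/andP: hd => d0 _; split; last by rewrite ge_min lexx orbT.
by rewrite lt_min d0; lra.
Qed.

Let y2 : 2 <= y.
Proof.
have [d0 d2] := delta'_bounds; have : 1 <= k%:R :> R by rewrite ler1n.
rewrite /y ler_pdivlMr // => k1; lra.
Qed.

Lemma spread_gt0 : (0 < spread k delta)%N.
Proof.
case/andP: hd => d0 d1; rewrite /spread; case: ifP => // /andP[_ dd].
by rewrite truncn_gt0 ler_pdivlMr ?mul1r; lra.
Qed.

Lemma legal_top : legal (top_program n k gamma delta).
Proof.
apply: legal_uniform => j.
have -> : set0 = [set x in elements (([::], [::]) : state 'I_n)].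
  by apply/setP => x; rewrite !inE.
by apply: legal_loop; rewrite drop0.
Qed.

Lemma memory_top : (memory (top_program n k gamma delta) <= 4 * k)%N.
Proof.
apply: memory_uniform => j.
have -> : set0 = [set x in elements (([::], [::]) : state 'I_n)].
  by apply/setP => x; rewrite !inE.
by apply: memory_loop; rewrite ?drop0.
Qed.

(** The constant is [252 * 16 * 8]: 252 from the charge per element, 16 from [rounds], and 8 from
    trading [N * ln y] for [n * ln (k / delta)]. *)
Lemma comparisons_top : (comparisons (top_program n k gamma delta))%:R
  <= 252 * 128 * (n%:R / gamma ^+ 2 * ln (k%:R / delta)).
Proof.
have [g0 g2] := andP hg; have [d0 d1] := andP hd; have [d0' d2'] := delta'_bounds.
have [_ rle l2] := rounds_spec g0 g2 y2.
have gg0 : 0 < gamma ^+ 2 by rewrite exprn_gt0.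
have [j cj] := comparisons_uniform (spread k delta).-1 (fun j =>
  core R (rounds gamma y) k (residue n (spread k delta) j)).
have kd1 : 1 <= k%:R / delta.
  rewrite ler_pdivlMr // mul1r; have : 1 <= k%:R :> R by rewrite ler1n.
  lra.
have L0 : 0 <= ln (k%:R / delta) by rewrite ln_ge0.
have cost := comparisons_core R k0 (isT : (0 < rounds gamma y)%N)
  (residue_enum n (spread k delta) j).
move: (leq_trans cj cost); rewrite -(ler_nat R) => {cj cost} cost.
apply: le_trans cost _; case: ltnP => kN; last first.
  by rewrite muln0; rewrite !mulr_ge0 // invr_ge0 ltW.
rewrite mul1n 2!natrM.
set N := size _ in kN *; suff NL : N%:R * ln y <= 8 * (n%:R * ln (k%:R / delta)).
  apply: le_trans (_ : 252 * (16 * (ln y / gamma ^+ 2)) * N%:R <= _).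
    by rewrite ler_wpM2r // ler_wpM2l.
  have := ler_wpM2r (_ : 0 <= (gamma ^+ 2)^-1) NL; rewrite invr_ge0 => /(_ (ltW gg0)).
  by move: (_^-1) (ln _) (ln _) => z l1 l3; lra.
move: kN; rewrite /N /spread; case: ifP => [/andP[/eqP k_1 dlt]|dlt] kN {N}.
  (* Here [k = 1] and [ln y <= 1]. As [N >= 2], [N * m <= 2 * n]; with [1 <= 4 * m * (1 - delta)]
     and [1 - delta <= ln (1 / delta)] this gives [N <= 8 * n * ln (1 / delta)]. *)
  set m := Num.truncn _ in kN *.
  have z0 : 0 < 1 - delta by lra.
  have t0 : 0 <= 1 / (2 * (1 - delta)) by rewrite divr_ge0 // mulr_ge0 // ltW.
  have m0 : (0 < m)%N.
    by have := spread_gt0; rewrite /spread k_1 eqxx dlt.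
  have /andP[_ +] := truncn_itv t0; rewrite -/m ltr_pdivrMr ?mulr_gt0 // => mlt.
  have m1 : 1 <= m%:R :> R by rewrite ler1n.
  rewrite -natr1 in mlt.
  have m4 : 1 <= 4 * (m%:R * (1 - delta)) by nra.
  have Nm : (size (residue n m j))%:R * m%:R <= 2 * n%:R :> R.
    rewrite -!natrM ler_nat; have := size_residue n j m0; move: kN.
    rewrite k_1; clear; move: (size _) => N; case: N => [|[|N]] //= _; nia.
  have ly : ln y <= 1.
    rewrite /y k_1 /delta' min_r ?(ltW dlt) // (_ : 1 / (1 / 2) = 1 + 1 :> R); last by field.
    by apply: le_ln1Dx; lra.
  have lz : 1 - delta <= ln (k%:R / delta).
    by apply: le_trans (ln_ge _); rewrite ?k_1 ?divr_gt0 // invf_div divr1.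
  have N0 : 0 <= (size (residue n m j))%:R :> R by [].
  have n0 : 0 <= n%:R :> R by [].
  apply: le_trans (_ : (size (residue n m j))%:R * 1 <= _); first by rewrite ler_wpM2l.
  apply: le_trans (ler_wpM2l N0 m4) _.
  have h1 := ler_wpM2r (ltW z0) Nm; have h2 := ler_wpM2l n0 lz.
  move: h1 h2; move: (ln _) => l1; lra.
have sN : (size (residue n 1 j) <= n)%N.
  by rewrite size_filter (leq_trans (count_size _ _)) // size_enum_ord.
(* If [delta <= 1 / 2] then [y = k / delta]; otherwise [k >= 2] and [y = 2 * k <= k ^ 2]. Either way
   [y] is at most the square of [k / delta]. *)
have ly : ln y <= 2 * ln (k%:R / delta).
  rewrite mulr_natl -lnXn ?divr_gt0 ?ltr0n // ler_ln ?posrE ?exprn_gt0 ?divr_gt0 ?ltr0n //.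
  rewrite /y /delta'; case: (lerP delta (1 / 2)) => h; first by rewrite ler_eXnr.
  have k2 : 2 <= k%:R :> R.
    rewrite ler_nat ltn_neqAle k0 andbT eq_sym; apply/negP => k_1.
    by move: dlt; rewrite k_1 h.
  have kd : k%:R <= k%:R / delta by rewrite ler_pdivlMr // ler_piMr // ltW.
  rewrite invf_div divr1 expr2; apply: le_trans (_ : k%:R * k%:R <= _).
    by rewrite ler_wpM2l.
  by apply: ler_pM.
apply: le_trans (ler_wpM2l _ ly) _ => //.
have : (size (residue n 1 j))%:R * ln (k%:R / delta) <= n%:R * ln (k%:R / delta).
  by rewrite ler_wpM2r // ler_nat.
have : 0 <= n%:R * ln (k%:R / delta) by rewrite mulr_ge0.
lra.
Qed.

Lemma output_prob_top (d : Order.disp_t) (T : orderType d) (s : n.-tuple T)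
    (adv : adversary n) : uniq s ->
  1 - delta <= output_prob gamma s adv (top_program n k gamma delta) (largest s k).
Proof.
move=> us; have [g0 g2] := andP hg; have [d0 d1] := andP hd.
have [d0' d2'] := delta'_bounds; have [k1 kn'] := andP kn.
have [er _ _] := rounds_spec g0 g2 y2.
set r := rounds gamma y in er; set e := (1 - gamma ^+ 2) ^+ r in er.
have e0 : 0 <= e.
  rewrite exprn_ge0 //; have : gamma ^+ 2 <= 1 ^+ 2.
    by rewrite lerXn2r ?nnegrE //; lra.
  by rewrite expr1n; lra.
rewrite /y invf_div in er.
have [th0 th2 eth small] := risk_small k0 d0' d2' e0 er.
set m := spread k delta; have m0 : (0 < m)%N by exact: spread_gt0.
have m0R : 0 < m%:R :> R by rewrite ltr0n.
(* For [k = 1] this is the class of the maximum; for larger [k] there is a single class. *)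
have [j [jm sub]] : exists j, (j < m)%N /\ {subset largest s k <= residue n m j}.
  case: (eqVneq k 1%N) => [k_1|kn1].
    have /cards1P[x0 lx0] : #|largest s k| == 1%N by rewrite card_largest // k_1.
    exists (x0 %% m)%N; split; first by rewrite ltn_mod.
    by move=> x; rewrite lx0 inE => /eqP ->; rewrite mem_filter mem_enum eqxx.
  have m1 : m = 1%N by rewrite /m /spread (negbTE kn1).
  by exists 0%N; rewrite m1; split=> // x _; rewrite mem_filter mem_enum modn1.
have ups : uniq (residue n m j) by exact/filter_uniq/enum_uniq.
have ks : (k <= size (residue n m j))%N.
  rewrite -{1}(card_largest us kn') cardE; apply: uniq_leq_size; first exact: enum_uniq.
  by move=> x; rewrite mem_enum => /sub.
have core_prob h : 1 - delta' <=
    output_prob_from gamma s adv (largest s k) h (core R r k (residue n m j)).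
  rewrite -(topmost_largest us ups ks kn' sub).
  apply: le_trans (core_ge _ g0 g2 us _ ups ks th0 th2 eth _ _) => //.
    by rewrite lerD2l lerN2.
  exact: residue_enum.
have := @uniform_ge R n gamma _ _ s adv (largest s k) m.-1
  (fun j => core R r k (residue n m j)) j (1 - delta') [::].
rewrite prednK // => h; apply: le_trans (h _ _ _) => //; last first.
- move=> i h'; apply: (output_prob_ge0 _ _ _ g0 g2 (t := 0)
    (mem := [set x in elements (([::], [::]) : state 'I_n)])).
  by apply: legal_loop; rewrite drop0.
- by rewrite -ltnS prednK.
rewrite ler_pdivlMr // /m /spread; case: ifP => [/andP[_ dlt]|dlt]; last first.
  rewrite mulr1 lerD2l lerN2 /delta' ge_min.
  by rewrite lexx.
(* The right class is drawn with probability [1 / m] and its pass succeeds with probability at least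
   1/2; [m <= 1 / (2 * (1 - delta))] makes the product at least [1 - delta]. *)
have -> : delta' = 1 / 2 by rewrite /delta' min_r // ltW.
have z0 : 0 < 1 - delta by lra.
have t0 : 0 <= 1 / (2 * (1 - delta)) by rewrite divr_ge0 // mulr_ge0 ?(ltW z0).
have /andP[+ _] := truncn_itv t0; rewrite ler_pdivlMr ?mulr_gt0 //.
move: (Num.truncn _) => M; nra.
Qed.

End Top.

Theorem theorem3 (R : realType) :
  exists (Cmem : nat) (Ccmp : R)
         (alg : forall (n k : nat) (gamma delta : R), program R n),
  forall (n k : nat) (gamma delta : R),
    (1 <= k <= n)%N -> 0 < gamma <= 1 / 2 -> 0 < delta < 1 ->
    let A := alg n k gamma delta in
    [/\ legal A,
        (memory A <= Cmem * k)%N,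
        (comparisons A)%:R <= Ccmp * (n%:R / gamma ^+ 2 * ln (k%:R / delta))
      & forall (d : Order.disp_t) (T : orderType d) (s : n.-tuple T)
               (adv : adversary n),
          uniq s -> output_prob gamma s adv A (largest s k) >= 1 - delta].
Proof.
exists 4%N, (252 * 128), (@top_program R) => n k gamma delta kn hg hd A; split.
- exact: legal_top.
- exact: memory_top.
- exact: comparisons_top.
- by move=> d T s adv us; exact: output_prob_top.
Qed.
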